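(* Let $\mathfrak{H}$ be a complex Hilbert space (finite or infinite dimensional) and let $0<r<1$ be a real number. Let $M: B(\mathfrak{H})^{+}\times B(\mathfrak{H})^{+}\to B(\mathfrak{H})^{+}$ be a map such that for all $A,B\in B(\mathfrak{H})^{+}$: (i) $M(A,B)\leq rA+(1-r)B$; (ii) $M(tA,B)=t^{r}M(A,B)$ for every real number $t>0$; (iii) $M(A,B)^{-1}=M(A^{-1},B^{-1})$. Then $M=M_{r}$, i.e. $M(A,B)=B^{1/2}(B^{-1/2}AB^{-1/2})^{r}B^{1/2}$ for all $A,B\in B(\mathfrak{H})^{+}$.
   Context: $B(\mathfrak{H})$ denotes the bounded linear operators on $\mathfrak{H}$, and $B(\mathfrak{H})^{+}$ denotes the set of all positive invertible operators in $B(\mathfrak{H})$. The order $\leq$ is the usual order on self-adjoint operators ($T\le S$ iff $\langle (S-T)\xi,\xi\rangle\ge 0$ for all $\xi\in\mathfrak{H}$), and real powers of positive invertible operators are defined by the continuous functional calculus. For $r>0$ and $A,B\in B(\mathfrak{H})^{+}$, $M_{r}(A,B)=B^{1/2}(B^{-1/2}AB^{-1/2})^{r}B^{1/2}$. The map $M$ is not assumed to be continuous or to have any property other than those listed. *)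

(* Defs.v *)
From HB Require Import structures.
From mathcomp Require Import all_boot all_order all_algebra.
From mathcomp Require Import complex.
From mathcomp Require Import all_classical all_reals all_analysis.

Set Implicit Arguments.
Unset Strict Implicit.
Unset Printing Implicit Defensive.

Import Order.TTheory GRing.Theory Num.Theory.

Local Open Scope classical_set_scope.
Local Open Scope ring_scope.
Local Open Scope complex_scope.

(* The inner product is linear in its first argument and conjugate-linear in
   its second one. The norm of H takes its (nonnegative real) values in R[i],
   as for every normed module over R[i]. *)
HB.mixin Record isHilbert (R : realType) H of CompleteNormedModule R[i] H := {
  inner : {dot H for Num.conj};
  inner_norm : forall x : H, inner x x = `|x| ^+ 2
}.

#[short(type="hilbertType")]
HB.structure Definition Hilbert (R : realType) :=
  {H of isHilbert R H & CompleteNormedModule R[i] H}.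

Section BoundedOperators.
Context {R : realType} {H : hilbertType R}.
Implicit Types f g : H -> H.

Definition bounded_linear : {pred H -> H} := fun f =>
  `[< linear f /\ exists c : R[i], forall x, `|f x| <= c * `|x| >].

Lemma bounded_linearP f :
  reflect (linear f /\ exists c : R[i], forall x, `|f x| <= c * `|x|)
          (f \in bounded_linear).
Proof. exact: asboolP. Qed.

Lemma bounded_linear_submod : submod_closed bounded_linear.
Proof.
split.
  apply/bounded_linearP; split=> [a x y|]; first by rewrite /= scaler0 addr0.
  by exists 0 => x; rewrite normr0 mul0r.
move=> a f g /bounded_linearP[lf [c fc]] /bounded_linearP[lg [d gd]].
apply/bounded_linearP; split=> [b x y|].
  rewrite !fctE lf lg !scalerDr !scalerA (mulrC a b) -!addrA.
  by congr (_ + _); rewrite addrCA.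
exists (`|a| * c + d) => x; rewrite !fctE mulrDl.
apply: le_trans (ler_normD _ _) _; apply: lerD => //.
by rewrite normrZ -mulrA ler_wpM2l.
Qed.

HB.instance Definition _ :=
  GRing.isSubmodClosed.Build _ _ bounded_linear bounded_linear_submod.

Lemma bounded_linear_id : idfun \in bounded_linear.
Proof.
by apply/bounded_linearP; split=> //; exists 1 => x; rewrite mul1r.
Qed.

Lemma bounded_linear_comp f g :
  f \in bounded_linear -> g \in bounded_linear -> f \o g \in bounded_linear.
Proof.
move=> /bounded_linearP[lf [c fc]] /bounded_linearP[lg [d gd]].
apply/bounded_linearP; split=> [b x y|]; first by rewrite /= lg lf.
exists (`|c| * d) => x /=; apply: le_trans (fc _) _; rewrite -mulrA.
apply: (@le_trans _ _ (`|c| * `|g x|)); last by rewrite ler_wpM2l.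
have [g0|/eqP g0] := eqVneq (g x) 0; first by rewrite g0 normr0 !mulr0.
have c_ge0 : 0 <= c.
  rewrite -(pmulr_lge0 c (x := `|g x|)) ?normr_gt0//; last exact/eqP.
  exact: le_trans (fc _).
by rewrite ger0_norm.
Qed.

End BoundedOperators.

Record bop (R : realType) (H : hilbertType R) := BOp {
  bop_fun :> H -> H;
  bop_funP : bop_fun \in bounded_linear
}.

Notation "''B(' H )" := (bop H) (format "''B(' H )") : type_scope.

Section BopAlgebra.
Context {R : realType} {H : hilbertType R}.
Implicit Types S T U : 'B(H).

HB.instance Definition _ := [isSub for @bop_fun R H].
HB.instance Definition _ := [Choice of 'B(H) by <:].
HB.instance Definition _ := [SubChoice_isSubLmodule of 'B(H) by <:].

Definition bop_one : 'B(H) := BOp bounded_linear_id.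
Definition bop_comp S T : 'B(H) :=
  BOp (bounded_linear_comp (bop_funP S) (bop_funP T)).

Lemma bop_compA : associative bop_comp. Proof. by move=> S T U; apply/val_inj. Qed.
Lemma bop_comp1l : left_id bop_one bop_comp. Proof. by move=> S; apply/val_inj. Qed.
Lemma bop_comp1r : right_id bop_one bop_comp. Proof. by move=> S; apply/val_inj. Qed.
Lemma bop_compDl : left_distributive bop_comp +%R.
Proof. by move=> S T U; apply/val_inj. Qed.
Lemma bop_compDr : right_distributive bop_comp +%R.
Proof.
move=> S T U; apply/val_inj/funext => x /=.
have /bounded_linearP[lS _] := bop_funP S.
by have := lS 1 (T x) (U x); rewrite !scale1r.
Qed.

HB.instance Definition _ := GRing.Zmodule_isPzRing.Build 'B(H)
  bop_compA bop_comp1l bop_comp1r bop_compDl bop_compDr.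

End BopAlgebra.

Section BopTheory.
Context {R : realType} {H : hilbertType R}.
Implicit Types (S T : 'B(H)) (f : R -> R).

Definition is_inverse T S : Prop := T * S = 1 /\ S * T = 1.

Definition invertible T : Prop := exists S, is_inverse T S.

(* Junk value 0 when T is not invertible. *)
Definition op_inv T : 'B(H) := xget 0 [set S | is_inverse T S].

Definition self_adjoint T : Prop :=
  forall x y : H, inner (T x) y = inner x (T y).

(* The order of R[i] is the partial one: 0 <= z means that z is a nonnegative
   real number. *)
Definition op_le T S : Prop := forall x : H, 0 <= inner ((S - T) x) x.

(* B(H)^+ *)
Definition positive_invertible : set 'B(H) :=
  [set T | [/\ self_adjoint T, op_le 0 T & invertible T]].

Definition spectrum T : set R[i] :=
  [set z : R[i] | ~ invertible (T - z *: (1 : 'B(H)))].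

(* The operator norm of T is at most c. *)
Definition op_norm_le T (c : R) : Prop :=
  forall x : H, `|T x| <= c%:C * `|x|.

Definition op_poly (p : {poly R}) T : 'B(H) :=
  \sum_(k < size p) (p`_k)%:C *: T ^+ k.

(* S is f(T) in the sense of the continuous functional calculus, for T
   self-adjoint (so that its spectrum is real) and f continuous on the spectrum
   of T: S is the limit in operator norm of p_n(T), where the p_n are
   polynomials which converge to f uniformly on the spectrum of T. *)
Definition is_fcalc T f S : Prop :=
  forall e : R, 0 < e -> exists2 p : {poly R},
    (forall l : R, spectrum T l%:C -> `|p.[l] - f l| <= e) &
    op_norm_le (op_poly p T - S) e.

(* Junk value 0 when there is no such S, which does not happen for T
   self-adjoint and f continuous on its spectrum. *)
Definition fcalc T f : 'B(H) := xget 0 [set S | is_fcalc T f S].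

(* T^s, for T in B(H)^+ *)
Definition op_pow T (s : R) : 'B(H) := fcalc T (fun l => l `^ s).

(* B^{1/2} (B^{-1/2} A B^{-1/2})^r B^{1/2} *)
Definition geometric_mean (r : R) (A B : 'B(H)) : 'B(H) :=
  op_pow B 2^-1 *
  op_pow (op_pow B (- 2^-1) * A * op_pow B (- 2^-1)) r *
  op_pow B 2^-1.

End BopTheory.

(* Main.v *)
Require Import Defs.
From HB Require Import structures.
From mathcomp Require Import all_boot all_order all_algebra.
From mathcomp Require Import complex.
From mathcomp Require Import all_classical all_reals all_analysis.
From mathcomp Require Import ring lra.

Set Implicit Arguments.
Unset Strict Implicit.
Unset Printing Implicit Defensive.

Import Order.TTheory GRing.Theory Num.Theory.
Import numFieldNormedType.Exports.

Local Open Scope classical_set_scope.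
Local Open Scope ring_scope.
Local Open Scope complex_scope.

(** Fix A and B, write S for the positive square root of B and D for its
    inverse, and set C = D A D and Y = D M(A,B) D.  The claim is that Y is the
    r-th power of C.

    By homogeneity, [M_le] for the pair (tA, B) bounds M(A,B) by a whole family
    of linear combinations of A and B, one for each t > 0; by [M_inv] the same
    holds for the inverse of M(A,B) with the inverses of A and B.  Conjugating by D,
    respectively by S, and taking t = 1/s in the first family and t = s in the
    second one gives, with q = s^r,
      q^-1 Y + q Y^-1 - 2 <= r (s^-1 C + s C^-1 - 2),
    which is the same as
      q^-1 (Y - q) Y^-1 (Y - q) <= r s^-1 (C - s) C^-1 (C - s).
    As Y^-1 is bounded below and C^-1 is bounded above, this yields a constant
    K such that |(Y - s^r) x| <= K |(C - s) x| for all vectors x and all s in an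
    interval that contains the spectrum of C ([mean_local_bound]).  On
    eigenvectors of C this says that Y acts as C^r, which is the whole proof in
    finite dimension.

    In general, [is_fcalc_of_local_bound] shows that such a bound, for a
    function f in the place of the power, forces Y = f(C).  A partition of unity
    by N + 1 polynomials w_j, concentrated at equally spaced points s_j, is
    obtained by grouping the Bernstein polynomials of degree N^2.  Then
    Y - sum_j f(s_j) w_j(C) = sum_j (Y - f(s_j)) w_j(C), each term is bounded by
    K (C - s_j) w_j(C), and the sum over j of the squares of (C - s_j) w_j(C) is
    O(N^-2); by the Cauchy-Schwarz inequality the difference is O(N^(-1/2)).  So
    Y is a norm limit of polynomials in C, and no separate existence theorem for
    f(C) is needed.  The same criterion identifies S and D with the powers 1/2
    and -1/2 of B, once a positive square root of B is known to exist.

    The limit is independent of the approximating polynomials because a real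
    polynomial that is nonnegative on the spectrum of a symmetric operator
    takes it to a positive operator ([op_poly_ge0]).  This rests on two facts:
    the least upper bound of a symmetric operator lies in its spectrum
    ([spectrum_max]), and a polynomial in T that is not invertible has a root in
    the spectrum of T ([op_poly_not_invertible]).  Inverses and square roots are
    found as fixed points of contractions ([bop_fixed_point]). *)

(** * The real inner product of a complex Hilbert space *)
Lemma Re_conj (R : realType) (z : R[i]) : complex.Re (Num.conj z) = complex.Re z.
Proof. by case: z. Qed.

Lemma Im_conj (R : realType) (z : R[i]) :
  complex.Im (Num.conj z) = - complex.Im z.
Proof. by case: z. Qed.

Section RealInner.
Context {R : realType} {H : hilbertType R}.
Implicit Types (x y z : H) (c : R) (T U : 'B(H)).

(** The real part of the inner product is a symmetric real bilinear form that
    determines the norm, and the quadratic form of a self-adjoint operator is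
    real; working with it turns all estimates into statements over R. *)
Definition rdot x y : R := complex.Re (inner x y).

Lemma rdotC x y : rdot x y = rdot y x.
Proof. by rewrite /rdot hermC expr0 mul1r; exact: Re_conj. Qed.

Lemma rdotDl x y z : rdot (x + y) z = rdot x z + rdot y z.
Proof. by rewrite /rdot linearDl raddfD. Qed.

Lemma rdotDr x y z : rdot z (x + y) = rdot z x + rdot z y.
Proof. by rewrite rdotC rdotDl 2!(rdotC z). Qed.

Lemma rdotZl c x y : rdot (c%:C *: x) y = c * rdot x y.
Proof. by rewrite /rdot linearZl_LR /=; case: (inner x y) => a b /=; ring. Qed.

Lemma rdotZr c x y : rdot x (c%:C *: y) = c * rdot x y.
Proof. by rewrite rdotC rdotZl rdotC. Qed.

Lemma rdotNl x y : rdot (- x) y = - rdot x y.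
Proof. by rewrite /rdot linearNl raddfN. Qed.

Lemma rdotNr x y : rdot x (- y) = - rdot x y.
Proof. by rewrite rdotC rdotNl rdotC. Qed.

Lemma rdot0l x : rdot 0 x = 0.
Proof. by rewrite /rdot linear0l. Qed.

Definition rdotE := (rdotDl, rdotDr, rdotNl, rdotNr, rdotZl, rdotZr).

Lemma normE x : `|x| = (Num.sqrt (rdot x x))%:C.
Proof.
have h : (complex.Re `|x|)%:C = `|x| by apply/RRe_real/normr_real.
rewrite -{1}h; congr (_ %:C).
rewrite /rdot inner_norm -h -rmorphXn /= sqrtr_sqr ger0_norm//.
by rewrite -ler0c h.
Qed.

Lemma rdot_ge0 x : 0 <= rdot x x.
Proof.
have : 0 <= inner x x by rewrite inner_norm exprn_ge0.
by rewrite lecE => /andP[].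
Qed.
#[local] Hint Resolve rdot_ge0 : core.

Lemma rdot_eq0 x : rdot x x = 0 -> x = 0.
Proof.
by move=> h; apply/eqP; rewrite -normr_eq0 normE h sqrtr0.
Qed.

Lemma rdot_ext x y : (forall z, rdot x z = rdot y z) -> x = y.
Proof.
move=> h; apply/eqP; rewrite -subr_eq0; apply/eqP/rdot_eq0.
by rewrite rdotDl rdotNl h subrr.
Qed.

Lemma norm_leE x y c : 0 <= c ->
  (`|x| <= c%:C * `|y|) = (rdot x x <= c ^+ 2 * rdot y y).
Proof.
move=> c0; rewrite !normE -rmorphM /= lecR -{1}(ger0_norm c0) -sqrtr_sqr.
by rewrite -sqrtrM ?sqr_ge0// ler_sqrt// mulr_ge0// sqr_ge0.
Qed.

Lemma op_norm_leP T c : 0 <= c ->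
  op_norm_le T c <-> forall x, rdot (T x) (T x) <= c ^+ 2 * rdot x x.
Proof. by move=> c0; split=> h x; have := h x; rewrite norm_leE. Qed.

Lemma bop_linear T : linear T.
Proof. by have /bounded_linearP[] := bop_funP T. Qed.

HB.instance Definition _ T :=
  GRing.isLinear.Build R[i] H H _ (bop_fun T) (@bop_linear T).

Lemma bop_addr T x y : T (x + y) = T x + T y. Proof. exact: linearD. Qed.
Lemma bop_oppr T x : T (- x) = - T x. Proof. exact: linearN. Qed.
Lemma bop_scaler T (a : R[i]) x : T (a *: x) = a *: T x.
Proof. exact: linearZ. Qed.

Lemma bop_ext T U : (forall x, T x = U x) -> T = U.
Proof. by move=> h; apply/val_inj/funext. Qed.

Lemma bopD T U x : (T + U) x = T x + U x. Proof. by []. Qed.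
Lemma bopN T x : (- T) x = - T x. Proof. by []. Qed.
Lemma bopM T U x : (T * U) x = T (U x). Proof. by []. Qed.
Lemma bopZ (a : R[i]) T x : (a *: T) x = a *: T x. Proof. by []. Qed.
Lemma bop1 x : (1 : 'B(H)) x = x. Proof. by []. Qed.
Lemma bop0 x : (0 : 'B(H)) x = 0. Proof. by []. Qed.
Lemma bop_sum I (r : seq I) (P : pred I) (F : I -> 'B(H)) x :
  (\sum_(i <- r | P i) F i) x = \sum_(i <- r | P i) F i x.
Proof. by elim/big_rec2: _ => // i y U _ <-. Qed.

Definition bop_linE := (bop_addr, bop_oppr, bop_scaler).
Definition bopE := (bopD, bopN, bopM, bopZ, bop1, bop0).

Lemma bop_scaleMr (a : R[i]) T U : T * (a *: U) = a *: (T * U).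
Proof. by apply: bop_ext => x; rewrite !bopE linearZ. Qed.

Lemma bop_scaleMl (a : R[i]) T U : (a *: T) * U = a *: (T * U).
Proof. by apply: bop_ext. Qed.

(** The constant given by boundedness is a complex number; it is nonnegative as
    soon as H contains a nonzero vector, and adding 1 makes it positive. *)
Lemma op_norm_le_exists T : exists2 c : R, 0 < c & op_norm_le T c.
Proof.
have /bounded_linearP[_ [d hd]] := bop_funP T.
have dN : `|d| = (complex.Re `|d|)%:C by rewrite RRe_real// normr_real.
have d0 : 0 <= complex.Re `|d| by rewrite -ler0c -dN.
exists (complex.Re `|d| + 1); first by lra.
move=> x; rewrite rmorphD /= -dN.
have [x0|x0] := eqVneq x 0; first by rewrite x0 linear0 !normr0 mulr0.
have d_ge0 : 0 <= d.
  rewrite -(pmulr_lge0 d (x := `|x|)) ?normr_gt0//.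
  exact: le_trans (hd _).
apply: le_trans (hd x) _; rewrite ler_wpM2r// ger0_norm// lerDl.
by rewrite ler0c.
Qed.

(** Self-adjointness for the real form: replacing x by 'i x recovers the
    imaginary part of the complex condition, see [self_adjointP]. *)
Definition symmetric T := forall x y, rdot (T x) y = rdot x (T y).

Definition op_ge_scal T c := forall x, c * rdot x x <= rdot (T x) x.
Definition op_le_scal T c := forall x, rdot (T x) x <= c * rdot x x.

Lemma symmetric0 : symmetric 0.
Proof. by move=> x y; rewrite !bop0 (rdotC x) !rdot0l. Qed.

Lemma self_adjointP T : self_adjoint T <-> symmetric T.
Proof.
split=> h x y; first by rewrite /rdot h.
have h1 := h x y; have h2 := h ('i%C *: x) y.
move: h1 h2; rewrite /rdot linearZ /= !linearZl_LR /=.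
case: (inner (T x) y) => a b; case: (inner x (T y)) => a' b' /= -> hb.
congr (_ +i* _); lra.
Qed.

Lemma op_le_rdot T U : op_le T U -> forall x, rdot (T x) x <= rdot (U x) x.
Proof.
move=> h x; have := h x; rewrite lecE => /andP[_].
rewrite -[complex.Re (inner _ _)]/(rdot _ _) !bopE !rdotE /=; lra.
Qed.

Lemma op_le_symmetric T U : symmetric T -> symmetric U ->
  (forall x, rdot (T x) x <= rdot (U x) x) -> op_le T U.
Proof.
move=> /self_adjointP sT /self_adjointP sU h x.
have := h x; rewrite -subr_ge0 -rdotNl -rdotDl /rdot => h'.
rewrite lecE h' andbT /=.
have : complex.Im (inner ((U - T) x) x) = - complex.Im (inner ((U - T) x) x).
  rewrite -Im_conj.
  have e : inner ((U - T) x) x = inner x ((U - T) x).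
    by rewrite !bopE linearBr linearBl /= sT sU.
  by rewrite [in LHS]e hermC expr0 mul1r.
by move=> hb; apply/eqP; lra.
Qed.

(** The nonnegativity of the square norm of c x - T x replaces the
    Cauchy-Schwarz inequality. *)
Lemma op_norm_le_scal T c : op_norm_le T c -> 0 < c -> op_le_scal T c.
Proof.
move=> hT c0 x; have := (op_norm_leP _ (ltW c0)).1 hT x => h.
have := rdot_ge0 (c%:C *: x - T x); rewrite !rdotE (rdotC x (T x)).
set a := rdot (T x) x; set b := rdot x x in h *; set d := rdot (T x) _ in h *.
move=> h2; have : 2 * c * a <= 2 * c * (c * b) by lra.
by rewrite ler_pM2l//; lra.
Qed.

End RealInner.
#[global] Hint Resolve rdot_ge0 : core.

(** * Fixed points of contractions of operators *)
Section Completeness.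
Context {R : realType} {H : hilbertType R}.
Implicit Types (x y z : H) (T U G : 'B(H)).

Definition hnorm x : R := Num.sqrt (rdot x x).

Lemma norm_hnorm x : `|x| = (hnorm x)%:C.
Proof. exact: normE. Qed.

Lemma hnorm_ge0 x : 0 <= hnorm x.
Proof. exact: sqrtr_ge0. Qed.

Lemma hnorm_sqr x : hnorm x ^+ 2 = rdot x x.
Proof. exact/sqr_sqrtr/rdot_ge0. Qed.

Lemma hnormD x y : hnorm (x + y) <= hnorm x + hnorm y.
Proof. by have := ler_normD x y; rewrite !norm_hnorm -rmorphD /= lecR. Qed.

Lemma hnormN x : hnorm (- x) = hnorm x.
Proof. by rewrite /hnorm !rdotE opprK. Qed.

Lemma hnormZ c x : hnorm (c%:C *: x) = `|c| * hnorm x.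
Proof. by rewrite /hnorm !rdotE mulrA -expr2 sqrtrM ?sqr_ge0// sqrtr_sqr. Qed.

Lemma hnorm0 : hnorm (0 : H) = 0.
Proof. by rewrite /hnorm rdot0l sqrtr0. Qed.

Lemma hnorm_eq0 x : hnorm x = 0 -> x = 0.
Proof. by move=> h; apply/eqP; rewrite -normr_eq0 norm_hnorm h. Qed.

(** The Cauchy-Schwarz inequality is read off from the triangle inequality, which
    is part of the normed structure. *)
Lemma rdot_le_hnorm x y : rdot x y <= hnorm x * hnorm y.
Proof.
have : hnorm (x + y) ^+ 2 <= (hnorm x + hnorm y) ^+ 2.
  by rewrite lerXn2r ?nnegrE ?addr_ge0 ?hnorm_ge0// hnormD.
rewrite sqrrD !hnorm_sqr !rdotE (rdotC y x); lra.
Qed.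

Lemma op_normP T c : op_norm_le T c <-> forall x, hnorm (T x) <= c * hnorm x.
Proof. by split=> h x; have := h x; rewrite !norm_hnorm -rmorphM /= lecR. Qed.

Lemma op_norm_le_trans T c d : c <= d -> op_norm_le T c -> op_norm_le T d.
Proof.
move=> cd /op_normP h; apply/op_normP => x; apply: le_trans (h x) _.
by rewrite ler_wpM2r// hnorm_ge0.
Qed.

Lemma op_normD T U c d :
  op_norm_le T c -> op_norm_le U d -> op_norm_le (T + U) (c + d).
Proof.
move=> /op_normP hT /op_normP hU; apply/op_normP => x; rewrite bopD mulrDl.
exact: le_trans (hnormD _ _) (lerD (hT x) (hU x)).
Qed.

Lemma op_normM T U c d : 0 <= c ->
  op_norm_le T c -> op_norm_le U d -> op_norm_le (T * U) (c * d).
Proof.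
move=> c0 /op_normP hT /op_normP hU; apply/op_normP => x; rewrite bopM.
by apply: le_trans (hT _) _; rewrite -mulrA ler_wpM2l.
Qed.

Lemma op_normZ T (a c : R) : op_norm_le T c -> op_norm_le (a%:C *: T) (`|a| * c).
Proof.
move=> /op_normP hT; apply/op_normP => x; rewrite bopZ hnormZ -mulrA.
by rewrite ler_wpM2l.
Qed.

Lemma op_norm1 : op_norm_le (1 : 'B(H)) 1.
Proof. by apply/op_normP => x; rewrite mul1r. Qed.

Lemma op_normN T c : op_norm_le T c -> op_norm_le (- T) c.
Proof. by move=> /op_normP hT; apply/op_normP => x; rewrite bopN hnormN. Qed.

Lemma geometric_small (rho D e : R) : 0 <= rho -> rho < 1 -> 0 < e ->
  exists n, D * rho ^+ n < e.
Proof.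
move=> r0 r1 e0.
have : (fun n => D * rho ^+ n) @ \oo --> (0 : R).
  rewrite -(mulr0 D); apply: cvgMr; apply: cvg_expr.
  by rewrite ger0_norm.
move=> /cvgr0_norm_lt /(_ _ e0) [N _ hN]; exists N.
by apply: le_lt_trans (ler_norm _) _; apply: (hN N) => /=.
Qed.

(** Used to pass to the limit in estimates whose error decays geometrically. *)
Lemma le_geometric (rho D a b : R) : 0 <= rho -> rho < 1 ->
  (forall n, a <= b + D * rho ^+ n) -> a <= b.
Proof.
move=> r0 r1 h; apply/ler_addgt0Pr => e e0.
have [n hn] := geometric_small D r0 r1 e0.
by apply: le_trans (h n) _; rewrite lerD2l ltW.
Qed.

Lemma vector_geometric_cvg (u : nat -> H) (rho D : R) : 0 <= rho -> rho < 1 ->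
  (forall n k, hnorm (u (n + k)%N - u n) <= D * rho ^+ n) ->
  exists l, forall n, hnorm (l - u n) <= D * rho ^+ n.
Proof.
move=> r0 r1 hu.
have cu : cvg (u @ \oo).
  apply/cauchy_cvgP; apply: cauchy_exP => e e0.
  have eE : e = (complex.Re e)%:C by rewrite RRe_real// gtr0_real.
  have e0' : 0 < complex.Re e by rewrite -ltcR -eE.
  have [n hn] := geometric_small D r0 r1 e0'.
  exists (u n); exists n => // m /= nm.
  rewrite -ball_normE /= -opprB normrN norm_hnorm eE ltcR.
  by apply: le_lt_trans hn; rewrite -(subnKC nm).
exists (lim (u @ \oo)) => n.
apply/ler_addgt0Pr => e e0.
have e0' : (0 : R[i]) < e%:C by rewrite ltcR.
have /cvgrPdist_le /(_ _ e0') [N _ hN] := cu.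
have := hN (n + N)%N; rewrite /= leq_addl => /(_ isT).
rewrite norm_hnorm lecR => h1.
have -> : lim (u @ \oo) - u n
  = (lim (u @ \oo) - u (n + N)%N) + (u (n + N)%N - u n) by rewrite addrA subrK.
by apply: le_trans (hnormD _ _) _; rewrite addrC lerD.
Qed.

(** Operators inherit completeness from H: the pointwise limit is linear and
    bounded because each vector is approximated at a rate proportional to its
    norm. *)
Lemma bop_geometric_cvg (F : nat -> 'B(H)) (rho c : R) :
  0 <= c -> 0 <= rho -> rho < 1 ->
  (forall n, op_norm_le (F n.+1 - F n) (c * rho ^+ n)) ->
  exists G, forall n, op_norm_le (G - F n) (c / (1 - rho) * rho ^+ n).
Proof.
move=> c0 r0 r1 hF.
set D := c / (1 - rho).
have D0 : 0 <= D by rewrite divr_ge0// subr_ge0 ltW.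
have Dc : D * (1 - rho) = c by rewrite divfK// subr_eq0 gt_eqF.
have key x n k :
    hnorm (F (n + k)%N x - F n x) <= D * hnorm x * rho ^+ n * (1 - rho ^+ k).
  elim: k => [|k IH].
    by rewrite addn0 subrr hnorm0 expr0 subrr mulr0.
  rewrite addnS.
  have -> : F (n + k).+1 x - F n x
    = (F (n + k).+1 x - F (n + k)%N x) + (F (n + k)%N x - F n x).
    by rewrite addrA subrK.
  apply: le_trans (hnormD _ _) _.
  have /op_normP /(_ x) := hF (n + k)%N; rewrite bopD bopN => h.
  apply: le_trans (lerD h IH) _; rewrite exprD exprS -Dc.
  by lra.
have /choice [g hg] : forall x, exists l, forall n,
    hnorm (l - F n x) <= D * hnorm x * rho ^+ n.
  move=> x; apply: vector_geometric_cvg => // n k.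
  apply: le_trans (key x n k) _; rewrite ler_piMr//.
    exact: mulr_ge0 (mulr_ge0 D0 (hnorm_ge0 x)) (exprn_ge0 n r0).
  by rewrite gerBl exprn_ge0.
have lg : linear g.
  move=> a x y; apply/eqP; rewrite -subr_eq0; apply/eqP/hnorm_eq0/le_anti.
  rewrite hnorm_ge0 andbT.
  have [e eE] : exists e, `|a| = e%:C.
    by exists (complex.Re `|a|); rewrite RRe_real// normr_real.
  apply: (@le_geometric rho (D * (hnorm (a *: x + y) + e * hnorm x + hnorm y)))
    => // n; rewrite add0r.
  have -> : g (a *: x + y) - (a *: g x + g y) =
     (g (a *: x + y) - F n (a *: x + y)) +
     (- (a *: (g x - F n x)) + - (g y - F n y)).
    by apply: rdot_ext => z; rewrite !bop_linE scalerBr !rdotE; ring.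
  apply: le_trans (hnormD _ _) _; rewrite !mulrDr !mulrDl -addrA lerD//.
  apply: le_trans (hnormD _ _) _; rewrite !hnormN lerD//.
  have -> : hnorm (a *: (g x - F n x)) = e * hnorm (g x - F n x).
    by apply: complexI; rewrite rmorphM /= -eE -!norm_hnorm normrZ.
  have e0 : 0 <= e by rewrite -ler0c -eE.
  have := hg x n => h; apply: le_trans (ler_wpM2l e0 h) _.
  by lra.
have bg : g \in bounded_linear.
  apply/bounded_linearP; split=> //.
  have [d d0 /op_normP hd] := op_norm_le_exists (F 0%N).
  exists (D + d)%:C => x; rewrite !norm_hnorm -rmorphM /= lecR.
  have -> : g x = (g x - F 0%N x) + F 0%N x by rewrite subrK.
  apply: le_trans (hnormD _ _) _; rewrite mulrDl lerD//.
  by apply: le_trans (hg x 0%N) _; rewrite expr0 mulr1.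
exists (BOp bg) => n; apply/op_normP => x; rewrite bopD bopN /=.
by apply: le_trans (hg x n) _; rewrite mulrAC.
Qed.

(** Banach's fixed point theorem in a ball of operators.  The iterates start at 0,
    which is symmetric, and symmetry survives limits in norm; hence the third
    conclusion. *)
Lemma bop_fixed_point (Phi : 'B(H) -> 'B(H)) (rho c : R) :
  0 <= c -> 0 <= rho -> rho < 1 ->
  (forall U, op_norm_le U c -> op_norm_le (Phi U) c) ->
  (forall U V d, op_norm_le U c -> op_norm_le V c -> 0 <= d ->
     op_norm_le (U - V) d -> op_norm_le (Phi U - Phi V) (rho * d)) ->
  exists G, [/\ op_norm_le G c, Phi G = G &
    (forall U, symmetric U -> symmetric (Phi U)) -> symmetric G].
Proof.
move=> c0 r0 r1 hb hc.
pose F n := iter n Phi 0.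
have F0 : op_norm_le (0 : 'B(H)) c.
  by apply/op_normP => x; rewrite bop0 hnorm0 mulr_ge0 ?hnorm_ge0.
have FB n : op_norm_le (F n) c by elim: n => [|n IH]; [exact: F0|exact: hb].
have Fd n : op_norm_le (F n.+1 - F n) (c * rho ^+ n).
  elim: n => [|n IH]; first by rewrite /= subr0 expr0 mulr1; apply: hb.
  rewrite exprS mulrCA; apply: (hc (F n.+1) (F n)) => //.
  exact: mulr_ge0 c0 (exprn_ge0 n r0).
have [G hG] := bop_geometric_cvg c0 r0 r1 Fd.
have D0 : 0 <= c / (1 - rho) by rewrite divr_ge0// subr_ge0 ltW.
set D := c / _ in D0 hG.
have Gc : op_norm_le G c.
  apply/op_normP => x; apply: (@le_geometric rho (D * hnorm x)) => // n.
  have -> : G x = F n x + (G - F n) x by rewrite !bopE addrC subrK.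
  have /op_normP /(_ x) h1 := FB n; have /op_normP /(_ x) h2 := hG n.
  by apply: le_trans (hnormD _ _) _; rewrite lerD// mulrAC.
exists G; split=> //.
  apply/bop_ext => x; apply/eqP; rewrite -subr_eq0; apply/eqP/hnorm_eq0/le_anti.
  rewrite hnorm_ge0 andbT.
  apply: (@le_geometric rho ((rho * D + rho * D) * hnorm x)) => // n.
  rewrite add0r.
  have -> : Phi G x - G x = (Phi G - Phi (F n)) x - (G - F n.+1) x.
    by rewrite !bopE /= opprB addrA subrK.
  apply: le_trans (hnormD _ _) _; rewrite hnormN !mulrDl lerD//.
    have Dn := mulr_ge0 D0 (exprn_ge0 n r0).
    have /op_normP /(_ x) h := hc _ _ _ Gc (FB n) Dn (hG n).
    apply: le_trans h _.
    by lra.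
  have /op_normP /(_ x) h := hG n.+1.
  apply: le_trans h _; rewrite exprS.
  by lra.
move=> hs x y.
have Fs n : symmetric (F n).
  by elim: n => [|n IH] /=; [exact: symmetric0|exact: hs].
suff h u v : rdot (G u) v <= rdot u (G v).
  by apply/le_anti; rewrite h (rdotC x) (rdotC (G x)) h.
apply: (@le_geometric rho (2 * D * hnorm u * hnorm v)) => // n.
have -> : rdot (G u) v =
    rdot u (G v) + (rdot ((G - F n) u) v + rdot u ((- (G - F n)) v)).
  by rewrite !bopE !rdotE -Fs; ring.
rewrite lerD2l.
have /op_normP hu := hG n; have /op_normP hv := op_normN (hG n).
apply: le_trans (lerD (rdot_le_hnorm _ _) (rdot_le_hnorm _ _)) _.
have hu' := ler_wpM2r (hnorm_ge0 v) (hu u).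
have hv' := ler_wpM2l (hnorm_ge0 u) (hv v).
by apply: le_trans (lerD hu' hv') _; lra.
Qed.

End Completeness.

(** * Inverses and square roots *)
Section Symmetric.
Context {R : realType} {H : hilbertType R}.
Implicit Types (x y z : H) (S T U G : 'B(H)).

Lemma symmetricD T U : symmetric T -> symmetric U -> symmetric (T + U).
Proof. by move=> hT hU x y; rewrite !bopE !rdotE hT hU. Qed.

Lemma symmetricN T : symmetric T -> symmetric (- T).
Proof. by move=> hT x y; rewrite !bopE !rdotE hT. Qed.

Lemma symmetric1 : symmetric (1 : 'B(H)).
Proof. by []. Qed.

Lemma symmetricZ T (c : R) : symmetric T -> symmetric (c%:C *: T).
Proof. by move=> hT x y; rewrite !bopE !rdotE hT. Qed.

Lemma symmetricM T U : symmetric T -> symmetric U -> T * U = U * T ->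
  symmetric (T * U).
Proof. by move=> hT hU c x y; rewrite {2}c !bopM hT hU. Qed.

Lemma symmetric_conj T U : symmetric T -> symmetric U -> symmetric (U * T * U).
Proof. by move=> hT hU x y; rewrite !bopM hU hT hU. Qed.

Lemma is_inverse_sym S T : is_inverse T S -> is_inverse S T.
Proof. by case. Qed.

Lemma is_inverse_lr T L S : L * T = 1 -> T * S = 1 -> is_inverse T S.
Proof.
move=> hL hS; split=> //.
by rewrite -[S]mul1r -hL -[L * T * S]mulrA hS mulr1.
Qed.

Lemma is_inverseN T S : is_inverse T S -> is_inverse (- T) (- S).
Proof. by move=> [h1 h2]; split; rewrite mulrNN. Qed.

Lemma is_inverse_uniq T S U : is_inverse T S -> is_inverse T U -> S = U.
Proof. by move=> [_ h1] [h2 _]; rewrite -[S]mulr1 -h2 mulrA h1 mul1r. Qed.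

Lemma is_inverseM T T' S S' : is_inverse T S -> is_inverse T' S' ->
  is_inverse (T * T') (S' * S).
Proof.
move=> [h1 h2] [h3 h4]; split.
  by rewrite -mulrA (mulrA T') h3 mul1r.
by rewrite -mulrA (mulrA S) h2 mul1r.
Qed.

Lemma op_invE T S : is_inverse T S -> op_inv T = S.
Proof.
move=> hS; rewrite /op_inv; case: xgetP => [U _ hU|/(_ S)//].
exact: is_inverse_uniq hU hS.
Qed.

Lemma symmetric_inverse T S : is_inverse T S -> symmetric T -> symmetric S.
Proof.
move=> [hTS _] hT x y.
have e z : T (S z) = z by rewrite -bopM hTS.
by rewrite -{1}(e y) -hT e.
Qed.

Lemma inverse_ge0 T S : is_inverse T S -> symmetric T ->
  op_ge_scal T 0 -> op_ge_scal S 0.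
Proof.
move=> hi hT h x; have [hTS _] := hi; rewrite mul0r.
have := h (S x); rewrite mul0r -bopM hTS bop1.
by rewrite rdotC.
Qed.

(** If c bounds the norm of the inverse S, testing the positivity of T at the
    vector x - c^-1 S x gives <T x, x> >= c^-1 |x|^2. *)
Lemma inverse_lower_bound T S : is_inverse T S -> symmetric T -> op_ge_scal T 0 ->
  exists2 m, 0 < m & op_ge_scal T m.
Proof.
move=> hi hT h; have [hTS _] := hi.
have [c c0 hc] := op_norm_le_exists S.
exists c^-1 => [|x]; first by rewrite invr_gt0.
have := h (x - c^-1%:C *: S x).
rewrite mul0r bop_addr bop_oppr bop_scaler -bopM hTS bop1 !rdotE.
rewrite (hT x (S x)) -bopM hTS bop1 (rdotC x (S x)) => h1.
have h2 := op_norm_le_scal hc c0 x.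
have : c^-1 * (c^-1 * rdot (S x) x) <= c^-1 * rdot x x.
  rewrite ler_pM2l ?invr_gt0//; apply: le_trans (_ : c^-1 * (c * rdot x x) <= _).
    by rewrite ler_pM2l ?invr_gt0.
  by rewrite mulrA mulVf ?mul1r// gt_eqF.
lra.
Qed.

(** This is T^2 <= c T <= c^2.  The first inequality comes from
    T (c - T) = c^-1 ((c - T) T (c - T) + T (c - T) T), whose right-hand side is
    a sum of conjugates of positive operators. *)
Lemma op_norm_le_of_bounds T c : 0 < c -> symmetric T -> op_ge_scal T 0 ->
  op_le_scal T c -> op_norm_le T c.
Proof.
move=> c0 sT h0 hc; apply/op_norm_leP; first exact: ltW.
move=> x.
have h1 := h0 (c%:C *: x - T x); have h2 := hc (T x); have h3 := hc x.
move: h1; rewrite mul0r bop_addr bop_oppr bop_scaler !rdotE.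
rewrite (sT (T x) x) => h1.
have : c * rdot (T x) (T x) <= c * (c * rdot (T x) x) by lra.
rewrite ler_pM2l// => h4; apply: le_trans h4 _.
by rewrite expr2 -mulrA ler_pM2l.
Qed.

Lemma op_ge_inj T d x : 0 < d -> op_ge_scal T d -> T x = 0 -> x = 0.
Proof.
move=> d0 h e; apply: rdot_eq0; apply/le_anti; rewrite rdot_ge0 andbT.
by have := h x; rewrite e rdot0l pmulr_rle0.
Qed.

(** After rescaling, a symmetric operator that is bounded below is at distance
    less than 1 from the identity. *)
Lemma scaled_complement_contraction T d : 0 < d -> symmetric T -> op_ge_scal T d ->
  exists b rho, [/\ 0 < b, 0 < rho, rho < 1,
    symmetric (1 - b^-1%:C *: T) & op_norm_le (1 - b^-1%:C *: T) rho].
Proof.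
move=> d0 sT hd; have [c c0 hc] := op_norm_le_exists T.
have hc' := op_norm_le_scal hc c0.
have b0 : 0 < c + d by rewrite addr_gt0.
exists (c + d), (c / (c + d)).
have sX : symmetric (1 - (c + d)^-1%:C *: T).
  by apply: symmetricD symmetric1 _; apply/symmetricN/symmetricZ.
have bV : (c + d) * (c + d)^-1 = 1 by rewrite mulfV// gt_eqF.
have V0 : 0 < (c + d)^-1 by rewrite invr_gt0.
split=> //; [by rewrite divr_gt0|by rewrite ltr_pdivrMr ?mul1r ?ltrDl|].
apply: op_norm_le_of_bounds; rewrite ?divr_gt0// => x;
    rewrite !bopE !rdotE.
  have h : (c + d)^-1 * rdot (T x) x <= (c + d)^-1 * ((c + d) * rdot x x).
    rewrite ler_pM2l//; apply: le_trans (hc' x) _.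
    by rewrite ler_wpM2r ?rdot_ge0// lerDl ltW.
  by move: h; rewrite mulrA (mulrC _ (c + d)) bV; lra.
have h : (c + d)^-1 * (d * rdot x x) <= (c + d)^-1 * rdot (T x) x.
  by rewrite ler_pM2l.
have -> : c / (c + d) = 1 - (c + d)^-1 * d by rewrite -bV; ring.
by lra.
Qed.

(** The fixed point of U |-> 1 + X U, with X = 1 - b^-1 T, is a right inverse of
    b^-1 T (the Neumann series); it is also a left inverse because T is
    injective. *)
Lemma op_ge_invertible T d : 0 < d -> symmetric T -> op_ge_scal T d -> invertible T.
Proof.
move=> d0 sT hd.
have [b [rho [b0 r0 r1 sX nX]]] := scaled_complement_contraction d0 sT hd.
set X := 1 - _ in sX nX.
have [||| | |G [_ hG _]] := @bop_fixed_point _ _ (fun U => 1 + X * U) rho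
    (1 - rho)^-1; rewrite ?invr_ge0 ?subr_ge0 ?ltW//.
- move=> U hU; have := op_normD op_norm1 (op_normM (ltW r0) nX hU).
  have -> // : 1 + rho / (1 - rho) = (1 - rho)^-1.
  by field; rewrite subr_eq0 gt_eqF.
- move=> U V e hU hV e0 hUV.
  rewrite opprD addrACA subrr add0r -mulrBr.
  exact: op_normM (ltW r0) nX hUV.
have hTG : T * (b^-1%:C *: G) = 1.
  rewrite bop_scaleMr -bop_scaleMl.
  have -> : b^-1%:C *: T = 1 - X by rewrite /X opprB addrC subrK.
  by rewrite mulrBl mul1r -{1}hG addrK.
exists (b^-1%:C *: G); split=> //; apply: bop_ext => x.
apply/eqP; rewrite -subr_eq0; apply/eqP/(op_ge_inj d0 hd).
by rewrite bop_addr bop_oppr -bopM mulrA hTG mul1r bop1 subrr.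
Qed.

(** With X = 1 - b^-1 T, the equation (1 - G)^2 = b^-1 T reads
    G = (X + G^2) / 2, and the right-hand side is a contraction of the ball whose
    radius is the norm of X, because this norm is less than 1. *)
Lemma op_sqrt_exists T d : 0 < d -> symmetric T -> op_ge_scal T d ->
  exists S, [/\ symmetric S, S * S = T & exists2 m, 0 < m & op_ge_scal S m].
Proof.
move=> d0 sT hd.
have [b [rho [b0 r0 r1 sX nX]]] := scaled_complement_contraction d0 sT hd.
set X := 1 - _ in sX nX.
have h0 : 0 <= 2^-1 :> R by lra.
have [||| | |G [nG hG sG]] := @bop_fixed_point _ _
    (fun U => 2^-1%:C *: (X + U * U)) rho rho; rewrite ?ltW//.
- move=> U hU; have := op_normZ 2^-1 (op_normD nX (op_normM (ltW r0) hU hU)).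
  apply: op_norm_le_trans; rewrite ger0_norm//.
  have : rho * rho <= rho * 1 by rewrite ler_pM2l// ltW.
  lra.
- move=> U V e hU hV e0 hUV.
  have -> : 2^-1%:C *: (X + U * U) - 2^-1%:C *: (X + V * V)
     = 2^-1%:C *: (U * (U - V) + (U - V) * V).
    rewrite -scalerBr opprD addrACA subrr add0r mulrBr mulrBl.
    by rewrite addrA subrK.
  have := op_normZ 2^-1 (op_normD (op_normM (ltW r0) hU hUV) (op_normM e0 hUV hV)).
  by apply: op_norm_le_trans; rewrite ger0_norm//; lra.
have {}sG : symmetric G.
  apply: sG => U sU; apply/symmetricZ/symmetricD => //.
  exact: symmetricM.
pose s := Num.sqrt b.
have s0 : 0 < s by rewrite sqrtr_gt0.
have sb : s * s = b by rewrite -expr2 sqr_sqrtr// ltW.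
exists (s%:C *: (1 - G)); split.
- by apply: symmetricZ; apply: symmetricD => //; exact: symmetricN.
- rewrite bop_scaleMr bop_scaleMl scalerA -rmorphM /= sb.
  have -> : (1 - G) * (1 - G) = b^-1%:C *: T.
    have -> : b^-1%:C *: T = 1 - X by rewrite /X opprB addrC subrK.
    rewrite mulrBl mul1r mulrBr mulr1.
    have e : G + G = X + G * G.
      rewrite -{1 2}hG -scalerDl -rmorphD /=.
      have -> : 2^-1 + 2^-1 = 1 :> R by lra.
      by rewrite scale1r.
    have -> : X = G + G - G * G by rewrite e addrK.
    by rewrite -addrA -opprD addrA.
  by rewrite scalerA -rmorphM /= mulfV ?gt_eqF// scale1r.
exists (s * (1 - rho)); first by rewrite mulr_gt0// subr_gt0.
move=> x; have := op_norm_le_scal nG r0 x.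
rewrite !bopE !rdotE -mulrA => h; rewrite ler_pM2l//; lra.
Qed.

End Symmetric.

(** * The spectrum of a symmetric operator *)
Section Spectrum.
Context {R : realType} {H : hilbertType R}.
Implicit Types (x y z : H) (S T U G : 'B(H)).

Lemma invertible_commr S T : S * T = T * S -> invertible (S * T) -> invertible S.
Proof.
move=> c [W [h1 h2]]; exists (T * W); apply: (is_inverse_lr (L := W * T)).
  by rewrite -mulrA -c.
by rewrite mulrA.
Qed.

(** The least upper bound u of U is a spectral value: if u - U were invertible, it
    would be bounded below by some m > 0, and u - m would be an upper bound. *)
Lemma spectrum_max U : symmetric U -> (1 : 'B(H)) <> 0 ->
  exists u, op_le_scal U u /\ spectrum U u%:C.
Proof.
move=> sU H0.
have [x0 x00] : exists x : H, 0 < rdot x x.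
  apply: contrapT => /forallNP h; apply: H0; apply: bop_ext => x.
  apply: rdot_eq0; apply/le_anti; rewrite rdot_ge0 andbT leNgt.
  exact/negP.
have [c c0 hc] := op_norm_le_exists U.
pose E := [set d | op_le_scal U d].
have Ec : E c by exact: op_norm_le_scal hc c0.
have lbE : lbound E (rdot (U x0) x0 / rdot x0 x0).
  by move=> d hd; rewrite ler_pdivrMr.
have iE : has_inf E by split; [exists c|exists (rdot (U x0) x0 / rdot x0 x0)].
have hu : op_le_scal U (inf E).
  move=> x; have [x1|x1] := eqVneq (rdot x x) 0.
    by rewrite (rdot_eq0 x1) linear0 !rdot0l mulr0.
  have {}x1 : 0 < rdot x x by rewrite lt_def x1 rdot_ge0.
  rewrite -ler_pdivrMr//; apply: lb_le_inf; first by exists c.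
  by move=> d hd; rewrite ler_pdivrMr.
exists (inf E); split => // -[W /is_inverseN hi]; rewrite opprB in hi.
have s' : symmetric ((inf E)%:C *: (1 : 'B(H)) - U).
  by apply: symmetricD; [apply/symmetricZ/symmetric1|exact: symmetricN].
have [|m m0 hm] := inverse_lower_bound hi s'.
  by move=> x; have := hu x; rewrite !bopE !rdotE; lra.
have : E (inf E - m).
  by move=> x; have := hm x; rewrite !bopE !rdotE; lra.
by move=> /(ge_inf iE.2); lra.
Qed.

Lemma spectrum_itv T a b l : symmetric T -> op_ge_scal T a -> op_le_scal T b ->
  spectrum T l%:C -> a <= l <= b.
Proof.
move=> sT ha hb hl; apply/andP; split; rewrite leNgt; apply/negP => h; apply: hl.
  apply: (@op_ge_invertible _ _ _ (a - l)); first by rewrite subr_gt0.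
    by apply: symmetricD => //; apply/symmetricN/symmetricZ/symmetric1.
  by move=> x; have := ha x; rewrite !bopE !rdotE; lra.
have [|||W /is_inverseN hi] :=
  @op_ge_invertible _ _ (l%:C *: (1 : 'B(H)) - T) (l - b).
- by rewrite subr_gt0.
- by apply: symmetricD; [apply/symmetricZ/symmetric1|exact: symmetricN].
- by move=> x; have := hb x; rewrite !bopE !rdotE; lra.
by exists (- W); rewrite opprB in hi.
Qed.

(** Spectral values of symmetric operators are approximate eigenvalues: otherwise
    (T - l)^2 is bounded below, hence invertible. *)
Lemma spectrum_approx T l e : symmetric T -> spectrum T l%:C -> 0 < e ->
  exists2 x, 0 < hnorm x & hnorm (T x - l%:C *: x) <= e * hnorm x.
Proof.
move=> sT hl e0; apply: contrapT => h; apply: hl.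
set S := T - _.
have sS : symmetric S.
  by apply: symmetricD => //; apply/symmetricN/symmetricZ/symmetric1.
apply: (@invertible_commr S S) => //.
apply: (@op_ge_invertible _ _ _ (e ^+ 2)).
- by rewrite exprn_gt0.
- exact: symmetricM.
move=> x; rewrite bopM sS; have [x0|x0] := eqVneq (hnorm x) 0.
  by rewrite -(hnorm_sqr x) x0 expr0n mulr0 rdot_ge0.
have {}x0 : 0 < hnorm x by rewrite lt_def x0 hnorm_ge0.
rewrite -!hnorm_sqr -exprMn lerXn2r ?nnegrE ?mulr_ge0 ?hnorm_ge0// 1?ltW//.
rewrite ltNge; apply/negP => h'; apply: h; by exists x.
Qed.

(** For z = a + i b with b nonzero, T - z is a factor of (T - a)^2 + b^2, which is
    bounded below by b^2. *)
Lemma spectrum_real T (z : R[i]) : symmetric T -> spectrum T z ->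
  z = (complex.Re z)%:C.
Proof.
case: z => a b sT hz /=; congr (_ +i* _); apply/eqP/negPn/negP => b0.
apply: hz; set w : R[i] := 'i%C * b%:C.
pose W : 'B(H) := w *: (1 : 'B(H)).
have -> : T - (a +i* b) *: (1 : 'B(H)) = (T - a%:C *: (1 : 'B(H))) - W.
  rewrite -addrA -opprD -scalerDl; congr (_ - _ *: _).
  rewrite /w; apply/eqP; rewrite eq_complex /=.
  by apply/andP; split; apply/eqP; ring.
rewrite -/W; set S : 'B(H) := T - _.
have sS : symmetric S.
  by apply: symmetricD => //; apply/symmetricN/symmetricZ/symmetric1.
have WS : W * S = S * W by rewrite /W bop_scaleMl bop_scaleMr mul1r mulr1.
have WW : - (W * W) = (b ^+ 2)%:C *: (1 : 'B(H)).
  rewrite /W bop_scaleMl bop_scaleMr mulr1 scalerA -scaleNr; congr (_ *: _).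
  rewrite /w; apply/eqP; rewrite eq_complex /=.
  by apply/andP; split; apply/eqP; ring.
clearbody S W.
have cS : (S - W) * (S + W) = S * S + (b ^+ 2)%:C *: (1 : 'B(H)).
  by rewrite mulrBl !mulrDr opprD addrA WS addrK WW.
have cS' : (S + W) * (S - W) = S * S + (b ^+ 2)%:C *: (1 : 'B(H)).
  by rewrite mulrDl !mulrBr addrA WS subrK WW.
apply: (@invertible_commr _ (S + W)); first by rewrite cS cS'.
rewrite cS; apply: (@op_ge_invertible _ _ _ (b ^+ 2)).
- by rewrite exprn_even_gt0.
- apply: symmetricD; first exact: symmetricM.
  exact/symmetricZ/symmetric1.
move=> x; rewrite !bopE !rdotE lerDr sS; exact: rdot_ge0.
Qed.

End Spectrum.

(** * Polynomials in a symmetric operator *)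
Section PolynomialCalculus.
Context {R : realType} {H : hilbertType R}.
Implicit Types (T : 'B(H)) (q : {poly R[i]}) (p : {poly R}).

(** Complex coefficients are needed to split real polynomials into linear
    factors. *)
Definition op_cpoly q T : 'B(H) := \sum_(k < size q) q`_k *: T ^+ k.

Lemma op_cpoly_widen q T n : (size q <= n)%N ->
  op_cpoly q T = \sum_(k < n) q`_k *: T ^+ k.
Proof.
move=> sn; rewrite /op_cpoly (big_ord_widen n (fun k => q`_k *: T ^+ k) sn).
rewrite big_mkcond; apply: eq_bigr => k _; case: ltnP => // h.
by rewrite nth_default// scale0r.
Qed.

Lemma op_cpolyD q1 q2 T : op_cpoly (q1 + q2) T = op_cpoly q1 T + op_cpoly q2 T.
Proof.
pose n := maxn (size q1) (size q2).
rewrite (@op_cpoly_widen q1 T n) ?leq_maxl//.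
rewrite (@op_cpoly_widen q2 T n) ?leq_maxr//.
rewrite (@op_cpoly_widen _ T n) ?size_polyD// -big_split /=.
by apply: eq_bigr => k _; rewrite coefD scalerDl.
Qed.

Lemma op_cpolyZ c q T : op_cpoly (c *: q) T = c *: op_cpoly q T.
Proof.
rewrite (@op_cpoly_widen _ T (size q)) ?size_scale_leq// scaler_sumr.
by apply: eq_bigr => k _; rewrite coefZ scalerA.
Qed.

Lemma op_cpolyC c T : op_cpoly c%:P T = c *: (1 : 'B(H)).
Proof.
rewrite (@op_cpoly_widen _ T 1) ?size_polyC ?leq_b1// big_ord1 coefC eqxx.
by rewrite expr0.
Qed.

Lemma op_cpolyMX q T : op_cpoly (q * 'X) T = op_cpoly q T * T.
Proof.
rewrite (@op_cpoly_widen _ T (size q).+1); last first.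
  by rewrite (leq_trans (size_polyMleq _ _))// size_polyX addn2.
rewrite big_ord_recl coefMX eqxx scale0r add0r mulr_suml.
by apply: eq_bigr => k _; rewrite coefMX /= bop_scaleMl exprSr.
Qed.

Lemma op_cpolyM q1 q2 T : op_cpoly (q1 * q2) T = op_cpoly q1 T * op_cpoly q2 T.
Proof.
elim/poly_ind: q2 => [|q c IH].
  rewrite mulr0; have -> : op_cpoly 0 T = 0.
    by rewrite /op_cpoly size_poly0 big_ord0.
  by rewrite mulr0.
rewrite mulrDr mulrA !op_cpolyD !op_cpolyMX IH mulrDr mulrA; congr (_ + _).
by rewrite mulrC mul_polyC op_cpolyZ op_cpolyC bop_scaleMr mulr1.
Qed.

Lemma op_cpolyX T : op_cpoly 'X T = T.
Proof. by rewrite -['X]mul1r op_cpolyMX op_cpolyC scale1r mul1r. Qed.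

Lemma op_cpoly_prod_invertible (s : seq R[i]) T :
  (forall z, z \in s -> invertible (T - z *: (1 : 'B(H)))) ->
  invertible (op_cpoly (\prod_(z <- s) ('X - z%:P)) T).
Proof.
elim: s => [|z s IH] h.
  by rewrite big_nil op_cpolyC scale1r; exists 1; split; rewrite mul1r.
rewrite big_cons op_cpolyM op_cpolyD op_cpolyX -polyCN op_cpolyC scaleNr.
have [U hU] := h z (mem_head _ _).
have [|V hV] := IH; first by move=> w hw; apply: h; rewrite inE hw orbT.
by exists (V * U); exact: is_inverseM.
Qed.

Lemma op_polyE p T : op_poly p T = op_cpoly (map_poly (real_complex R) p) T.
Proof.
rewrite /op_poly /op_cpoly size_map_poly.
by apply: eq_bigr => k _; rewrite coef_map.
Qed.

Lemma op_polyD p1 p2 T : op_poly (p1 + p2) T = op_poly p1 T + op_poly p2 T.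
Proof. by rewrite !op_polyE rmorphD op_cpolyD. Qed.

Lemma op_polyM p1 p2 T : op_poly (p1 * p2) T = op_poly p1 T * op_poly p2 T.
Proof. by rewrite !op_polyE rmorphM op_cpolyM. Qed.

Lemma op_polyZ c p T : op_poly (c *: p) T = c%:C *: op_poly p T.
Proof. by rewrite !op_polyE map_polyZ op_cpolyZ. Qed.

Lemma op_polyC c T : op_poly c%:P T = c%:C *: (1 : 'B(H)).
Proof. by rewrite op_polyE map_polyC op_cpolyC. Qed.

Lemma op_polyX T : op_poly 'X T = T.
Proof. by rewrite op_polyE map_polyX op_cpolyX. Qed.

Lemma op_polyN p T : op_poly (- p) T = - op_poly p T.
Proof. by rewrite -scaleN1r op_polyZ rmorphN1 scaleN1r. Qed.

Lemma op_poly_sum I (r : seq I) (P : pred I) (F : I -> {poly R}) T :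
  op_poly (\sum_(i <- r | P i) F i) T = \sum_(i <- r | P i) op_poly (F i) T.
Proof.
elim/big_rec2: _ => [|i U p _ <-]; last by rewrite op_polyD.
by rewrite op_polyC scale0r.
Qed.

Lemma op_poly_symmetric p T : symmetric T -> symmetric (op_poly p T).
Proof.
move=> sT.
have sE n : symmetric (T ^+ n).
  by elim: n => [|n IH]; [exact: symmetric1|rewrite exprS; apply: symmetricM => //;
    rewrite -exprS exprSr].
rewrite /op_poly; elim/big_ind: _ => [|U V|k _].
- exact: symmetric0.
- exact: symmetricD.
- exact: symmetricZ.
Qed.

(** Split p over the complex numbers: some factor T - z is not invertible, and
    such a z is a root of p and, T being symmetric, a real number. *)
Lemma op_poly_not_invertible p T : symmetric T -> ~ invertible (op_poly p T) ->
  exists2 l : R, spectrum T l%:C & p.[l] = 0.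
Proof.
move=> sT hp.
have H0 : (1 : 'B(H)) <> 0.
  move=> e; apply: hp; exists 0.
  by split; rewrite -[LHS]mulr1 e !mulr0.
(* The zero polynomial has no factors; a spectral value exists because the
   space is not trivial. *)
have [->|p0] := eqVneq p 0.
  by have [u [_ hu]] := spectrum_max sT H0; exists u => //; rewrite horner0.
set q := map_poly (real_complex R) p.
have q0 : lead_coef q != 0 by rewrite lead_coef_eq0 map_poly_eq0.
have [s qs] := closed_field_poly_normal q.
have [z zs hz] : exists2 z, z \in s & spectrum T z.
  apply: contrapT => h; apply: hp; rewrite op_polyE -/q qs op_cpolyZ.
  have [z zs|U [h1 h2]] := @op_cpoly_prod_invertible s T.
    by apply: contrapT => hz; apply: h; exists z.
  exists ((lead_coef q)^-1 *: U); split;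
    by rewrite bop_scaleMl bop_scaleMr scalerA ?h1 ?h2 ?mulfV ?mulVf// scale1r.
have zE := spectrum_real sT hz.
exists (complex.Re z); rewrite -?zE//.
have : root q z by rewrite qs rootZ// root_prod_XsubC.
by rewrite zE rootE horner_map /= => /eqP [].
Qed.

(** The largest spectral value of - p(T) is - p(l) for some spectral value l of T,
    hence it is not positive. *)
Lemma op_poly_ge0 p T : symmetric T ->
  (forall l : R, spectrum T l%:C -> 0 <= p.[l]) -> op_ge_scal (op_poly p T) 0.
Proof.
move=> sT hp x; rewrite mul0r.
have [e|H0] := pselect ((1 : 'B(H)) = 0).
  have -> : x = 0 by rewrite -[LHS]bop1 e bop0.
  by rewrite rdotC rdot0l.
have sp : symmetric (op_poly (- p) T) by exact: op_poly_symmetric.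
have [u [hu]] := spectrum_max sp H0.
rewrite /spectrum /= -(op_polyC u T) -(op_polyN u%:P) -op_polyD.
move=> /(op_poly_not_invertible sT) [l hl]; rewrite !hornerE => lu.
have := hu x; rewrite op_polyN !bopE !rdotE.
have := rdot_ge0 x; have := hp l hl => h1 h2.
have : u * rdot x x <= 0 by rewrite mulr_le0_ge0//; lra.
lra.
Qed.

Lemma op_poly_le p T x : symmetric T ->
  (forall l : R, spectrum T l%:C -> p.[l] <= 0) -> rdot (op_poly p T x) x <= 0.
Proof.
move=> sT hp; have /(_ x) : op_ge_scal (op_poly (- p) T) 0.
  by apply: op_poly_ge0 => // l hl; rewrite hornerN oppr_ge0 hp.
by rewrite op_polyN !bopE !rdotE mul0r oppr_ge0.
Qed.

Lemma op_poly_norm_le p T c : 0 <= c -> symmetric T ->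
  (forall l : R, spectrum T l%:C -> `|p.[l]| <= c) ->
  op_norm_le (op_poly p T) c.
Proof.
move=> c0 sT hp; apply/op_norm_leP => // x.
have := @op_poly_le (p * p - (c ^+ 2)%:P) T x sT.
rewrite op_polyD op_polyM op_polyN op_polyC !bopE !rdotE.
rewrite (op_poly_symmetric p sT (op_poly p T x)) subr_le0; apply => l hl.
rewrite !hornerE subr_le0 -expr2 -real_normK ?num_real//.
by rewrite lerXn2r ?nnegrE// hp.
Qed.

(** Two polynomials that are both close to f on the spectrum are close to each
    other there, so their values at T are close in norm. *)
Lemma is_fcalc_uniq T f S S' : symmetric T ->
  is_fcalc T f S -> is_fcalc T f S' -> S = S'.
Proof.
move=> sT h h'; apply: bop_ext => x; apply/eqP; rewrite -subr_eq0.
apply/eqP/hnorm_eq0/le_anti; rewrite hnorm_ge0 andbT.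
have key e : 0 < e -> hnorm (S x - S' x) <= 4 * e * hnorm x.
  move=> e0; have [p hp1 hp2] := h e e0; have [q hq1 hq2] := h' e e0.
  have /op_normP hd : op_norm_le (op_poly (p - q) T) (2 * e).
    apply: op_poly_norm_le => //; first by rewrite mulr_ge0// ltW.
    move=> l hl; rewrite hornerD hornerN.
    have := hp1 l hl; have := hq1 l hl; rewrite !ler_norml => /andP[? ?] /andP[? ?].
    by apply/andP; split; lra.
  have -> : S x - S' x = (op_poly (p - q) T x + - (op_poly p T - S) x)
      + (op_poly q T - S') x.
    apply: rdot_ext => z; rewrite op_polyD op_polyN !bopE !rdotE; ring.
  move: hp2 hq2 => /op_normP hp2 /op_normP hq2.
  apply: le_trans (hnormD _ _) _; apply: le_trans (lerD (hnormD _ _) (lexx _)) _.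
  rewrite hnormN; have := hp2 x; have := hq2 x; have := hd x; lra.
apply/ler_addgt0Pr => e e0; rewrite add0r.
have hx := hnorm_ge0 x.
have d0 : 0 < e / (4 * (hnorm x + 1)) by rewrite divr_gt0// mulr_gt0//; lra.
apply: le_trans (key _ d0) _.
rewrite [leLHS](_ : _ = e * (hnorm x / (hnorm x + 1))); last first.
  by field; rewrite gt_eqF//; lra.
rewrite ler_piMr//; first exact: ltW.
by rewrite ler_pdivrMr ?mul1r; lra.
Qed.

Lemma fcalcE T f S : symmetric T -> is_fcalc T f S -> fcalc T f = S.
Proof.
move=> sT h; rewrite /fcalc; case: xgetP => [U _ hU|/(_ S)//].
exact: is_fcalc_uniq sT hU h.
Qed.

End PolynomialCalculus.

(** * Bernstein polynomials and partitions of unity *)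
Section Bernstein.
Context {R : realType}.
Implicit Types (P : {poly R}) (g h : nat -> R) (n N : nat).

(** The sum of g k times the k-th Bernstein weight of degree n at P, for k from 0
    to n; that is, the mean of g at the number of successes in n independent
    trials of success probability P.  Conditioning on one trial gives the
    recursion, which avoids binomial coefficients. *)
Fixpoint bernstein P n g : {poly R} :=
  if n is n'.+1 then
    P * bernstein P n' (fun k => g k.+1) + (1 - P) * bernstein P n' g
  else (g 0%N)%:P.

Lemma eq_bernstein P n g h : (forall k, (k <= n)%N -> g k = h k) ->
  bernstein P n g = bernstein P n h.
Proof.
elim: n g h => [|n IH] g h gh /=; first by rewrite gh.
by congr (_ * _ + _ * _); apply: IH => k kn; apply: gh => //; exact: leqW.
Qed.

Lemma bernstein_cst P n (c : R) : bernstein P n (fun=> c) = c%:P.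
Proof. by elim: n => //= n ->; ring. Qed.

Lemma bernsteinD P n g h :
  bernstein P n (fun k => g k + h k) = bernstein P n g + bernstein P n h.
Proof.
elim: n g h => [|n IH] g h /=; first by rewrite polyCD.
by rewrite !IH; ring.
Qed.

Lemma bernsteinZ P n g (c : R) :
  bernstein P n (fun k => c * g k) = c *: bernstein P n g.
Proof.
rewrite -mul_polyC; elim: n g => [|n IH] g /=; first by rewrite polyCM.
by rewrite !IH; ring.
Qed.

Lemma bernstein_sum P n I (r : seq I) (G : I -> nat -> R) :
  bernstein P n (fun k => \sum_(i <- r) G i k)
  = \sum_(i <- r) bernstein P n (G i).
Proof.
elim: r => [|i r IH].
  rewrite big_nil -[RHS](bernstein_cst P n 0); apply: eq_bernstein => k _.
  by rewrite big_nil.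
rewrite big_cons -IH -bernsteinD; apply: eq_bernstein => k _.
by rewrite big_cons.
Qed.

Section Evaluation.
Variables (P : {poly R}) (l : R).
Hypothesis Pl : 0 <= P.[l] <= 1.

Lemma bernstein_ge0 n g : (forall k, (k <= n)%N -> 0 <= g k) ->
  0 <= (bernstein P n g).[l].
Proof.
have /andP[P0 P1] := Pl.
elim: n g => [|n IH] g hg /=; first by rewrite hornerC hg.
rewrite !hornerE addr_ge0// mulr_ge0 ?subr_ge0 ?IH// => k kn; apply: hg => //.
exact: leqW.
Qed.

Lemma bernstein_le n g h : (forall k, (k <= n)%N -> g k <= h k) ->
  (bernstein P n g).[l] <= (bernstein P n h).[l].
Proof.
move=> gh; rewrite -subr_ge0 -hornerN -hornerD -scaleN1r -bernsteinZ -bernsteinD.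
apply: bernstein_ge0 => k kn; have := gh k kn; lra.
Qed.

(** The second moment of a binomial law about an arbitrary point c; moving c is
    what makes the induction work. *)
Lemma bernstein_variance n (c : R) :
  (bernstein P n (fun k => (k%:R - c) ^+ 2)).[l]
  = n%:R * (P.[l] * (1 - P.[l])) + (n%:R * P.[l] - c) ^+ 2.
Proof.
elim: n c => [|n IH] c /=; first by rewrite hornerC; ring.
rewrite (@eq_bernstein P n _ (fun k => (k%:R - (c - 1)) ^+ 2)).
  by rewrite !hornerE !IH -natr1 /=; ring.
by move=> k _; rewrite -natr1; ring.
Qed.

End Evaluation.

(** In degree N^2 the Bernstein weights have standard deviation O(N^-1) when
    rescaled to the unit interval.  Grouping them into blocks of length N leaves
    N + 1 polynomials and only adds an error of the same order to the location.
    Without grouping there would be N^2 + 1 terms, too many for the application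
    of the Cauchy-Schwarz inequality in [is_fcalc_of_local_bound]. *)
Lemma bernstein_partition (a b : R) N : a < b -> (0 < N)%N ->
  exists (s : nat -> R) (w : nat -> {poly R}),
  [/\ forall j, (j < N.+1)%N -> a <= s j <= b,
      \sum_(j < N.+1) w j = 1 &
      forall l, a <= l <= b ->
      \sum_(j < N.+1) ((l - s j) * (w j).[l]) ^+ 2
        <= 3 * (b - a) ^+ 2 / N%:R ^+ 2].
Proof.
move=> ab N0.
have N0' : 0 < N%:R :> R by rewrite ltr0n.
have ba : 0 < b - a by rewrite subr_gt0.
pose P : {poly R} := (b - a)^-1 *: ('X - a%:P).
pose g (j k : nat) : R := (k %/ N == j)%N%:R.
exists (fun j => a + (b - a) * (j%:R / N%:R)), (fun j => bernstein P (N * N) (g j)).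
(* Each k <= N^2 lies in exactly one block, numbered by its quotient by N. *)
have gsum (F : nat -> R) k : (k <= N * N)%N ->
    \sum_(j < N.+1) F j * g j k = F (k %/ N)%N.
  move=> kN.
  have h : (k %/ N < N.+1)%N.
    by rewrite ltnS -[X in (_ <= X)%N](mulnK N N0) leq_div2r.
  rewrite (bigD1 (Ordinal h)) //= /g eqxx mulr1 big1 ?addr0// => j jk.
  case: eqP => [e|_]; last by rewrite mulr0.
  by case/eqP: jk; exact/val_inj.
split=> [j jN| |l /andP[al lb]].
- have /andP[u0 u1] : 0 <= (j%:R / N%:R : R) <= 1.
    by rewrite divr_ge0//= ler_pdivrMr// mul1r ler_nat -ltnS.
  have := mulr_ge0 (ltW ba) u0.
  have := ler_wpM2l (ltW ba) u1; lra.
- rewrite -[RHS](bernstein_cst P (N * N) 1).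
  rewrite -(bernstein_sum _ _ _ (fun j : 'I_N.+1 => g j)).
  apply: eq_bernstein => k kN.
  rewrite -[RHS](gsum (fun=> 1) k kN).
  by apply: eq_bigr => j _; rewrite mul1r.
set y := P.[l].
have yE : y = (l - a) / (b - a) by rewrite /y !hornerE mulrC.
have ly : l = a + (b - a) * y by rewrite yE; field; rewrite gt_eqF.
have y01 : 0 <= y <= 1.
  by rewrite yE divr_ge0 ?subr_ge0//= ?ler_pdivrMr ?mul1r; lra.
have w01 j : 0 <= (bernstein P (N * N) (g j)).[l] <= 1.
  rewrite bernstein_ge0//=.
    rewrite -[leRHS](hornerC 1 l) -(bernstein_cst P (N * N)).
    by apply: bernstein_le => // k _; rewrite /g lern1 leq_b1.
(* As 0 <= w j <= 1 on the interval, the square of w j may be replaced by w j. *)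
apply: (@le_trans _ _ (\sum_(j < N.+1) (b - a) ^+ 2 / N%:R ^+ 4 *
   (((N * N)%:R * y - N%:R * j%:R) ^+ 2 * (bernstein P (N * N) (g j)).[l]))).
  apply: ler_sum => j _; have /andP[w0 w1] := w01 j.
  set w := _.[l] in w0 w1 *.
  have -> : (l - (a + (b - a) * (j%:R / N%:R))) * w =
    (b - a) / N%:R ^+ 2 * ((N * N)%:R * y - N%:R * j%:R) * w.
    by rewrite ly natrM; field; rewrite gt_eqF.
  set u := (N * N)%:R * y - _.
  have -> : ((b - a) / N%:R ^+ 2 * u * w) ^+ 2
      = (b - a) ^+ 2 / N%:R ^+ 4 * (u ^+ 2 * (w * w)).
    by field; rewrite gt_eqF.
  apply: ler_wpM2l; first by rewrite divr_ge0 ?exprn_ge0 // ltW.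
  by apply: ler_wpM2l; rewrite ?sqr_ge0 ?ler_piMr.
rewrite -mulr_sumr.
have -> : \sum_(j < N.+1) (((N * N)%:R * y - N%:R * j%:R) ^+ 2 *
    (bernstein P (N * N) (g j)).[l])
  = (bernstein P (N * N) (fun k => ((N * N)%:R * y - N%:R * (k %/ N)%:R) ^+ 2)).[l].
  rewrite (@eq_bernstein P (N * N) _ (fun k =>
     \sum_(j < N.+1) ((N * N)%:R * y - N%:R * j%:R) ^+ 2 * g j k)).
    rewrite bernstein_sum -horner_evalE raddf_sum /=; apply: eq_bigr => j _.
    by rewrite horner_evalE bernsteinZ hornerZ.
  by move=> k kN; rewrite (gsum (fun j => ((N * N)%:R * y - N%:R * j%:R) ^+ 2)).
(* The distance from N^2 y to the start of the block of k is at most the sum of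
   the distance to k, controlled by the variance, and of N. *)
have hE : (bernstein P (N * N)
    (fun k => ((N * N)%:R * y - N%:R * (k %/ N)%:R) ^+ 2)).[l]
  <= 3 * N%:R ^+ 2.
  apply: (@le_trans _ _ (bernstein P (N * N)
     (fun k => 2 * (k%:R - (N * N)%:R * y) ^+ 2 + 2 * N%:R ^+ 2)).[l]).
    apply: bernstein_le => // k _.
    have kE : k%:R = N%:R * (k %/ N)%:R + (k %% N)%:R :> R.
      by rewrite -natrM -natrD mulnC -divn_eq.
    have r0 : 0 <= (k %% N)%:R :> R by [].
    have rN : (k %% N)%:R <= N%:R :> R by rewrite ler_nat ltnW// ltn_pmod.
    set c := (N * N)%:R * y; move: kE r0 rN.
    set m := (k %/ N)%:R; set r := (k %% N)%:R => -> r0 rN.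
    have : 0 <= (2 * (N%:R * m - c) + 3 / 2 * r) ^+ 2 by exact: sqr_ge0.
    have : r ^+ 2 <= N%:R ^+ 2 by rewrite lerXn2r ?nnegrE.
    have : 0 <= (N%:R * m - c + 2 * r) ^+ 2 by exact: sqr_ge0.
    nra.
  rewrite bernsteinD bernsteinZ bernstein_cst !hornerE bernstein_variance//.
  rewrite -/y subrr natrM.
  have y2 : y * (1 - y) <= 1 / 2 by have := sqr_ge0 (y - 1 / 2); lra.
  have n2 : 0 <= N%:R * N%:R :> R by rewrite mulr_ge0.
  have := ler_wpM2l n2 y2.
  by rewrite !expr2 /=; lra.
apply: le_trans (ler_wpM2l _ hE) _.
  by rewrite divr_ge0 ?exprn_ge0// ltW.
rewrite le_eqVlt; apply/orP; left; apply/eqP; field.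
by rewrite gt_eqF.
Qed.

End Bernstein.

(** * A criterion for the functional calculus *)
Section FunctionalCalculus.
Context {R : realType} {H : hilbertType R}.
Implicit Types (T Y : 'B(H)) (f : R -> R).

Lemma sqr_sum_le N (u : 'I_N -> R) :
  (\sum_j u j) ^+ 2 <= N%:R * \sum_j u j ^+ 2.
Proof.
have -> : N%:R * \sum_j u j ^+ 2 = \sum_i \sum_j (u i ^+ 2 + u j ^+ 2) / 2.
  have h i : \sum_j (u i ^+ 2 + u j ^+ 2) / 2
      = N%:R * u i ^+ 2 / 2 + (\sum_j u j ^+ 2) / 2.
    by rewrite -mulr_suml big_split /= sumr_const card_ord -[_ *+ N]mulr_natl mulrDl.
  under [RHS]eq_bigr do rewrite h.
  rewrite big_split /= -mulr_suml -mulr_sumr sumr_const card_ord -[_ *+ N]mulr_natl.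
  by field.
rewrite expr2 mulr_suml; apply: ler_sum => i _.
rewrite mulr_sumr; apply: ler_sum => j _.
have := sqr_ge0 (u i - u j); lra.
Qed.

Lemma hnorm_sum I (r : seq I) (F : I -> H) :
  hnorm (\sum_(i <- r) F i) <= \sum_(i <- r) hnorm (F i).
Proof.
elim/big_rec2: _ => [|i s v _ h]; first by rewrite hnorm0.
by apply: le_trans (hnormD _ _) _; rewrite lerD2l.
Qed.

(** The hypothesis says that Y acts almost as the scalar f s on the vectors on which
    T acts almost as the scalar s.  A partition of unity w_j around the points s_j
    decomposes x into such vectors w_j(T) x, so Y is approximated in norm by
    p(T), where p is the sum of the f(s_j) w_j.  Closeness of p to f on the
    spectrum is then automatic, whatever f is: at an approximate eigenvector of T
    for l, the operators p(T) and Y act almost as p(l) and f(l). *)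
Lemma is_fcalc_of_local_bound T Y f a b K :
  symmetric T -> op_ge_scal T a -> op_le_scal T b -> a < b -> 0 <= K ->
  (forall s x, a <= s <= b ->
     hnorm (Y x - (f s)%:C *: x) <= K * hnorm (T x - s%:C *: x)) ->
  is_fcalc T f Y.
Proof.
move=> sT ha hb ab K0 hY e e0.
have sp l : spectrum T l%:C -> a <= l <= b by exact: spectrum_itv.
(* The error is at most K (3 (N + 1) (b - a)^2 / N^2)^(1/2), and N + 1 <= 2 N. *)
pose N := (Num.truncn (6 * K ^+ 2 * (b - a) ^+ 2 / e ^+ 2)).+1.
have hN : 6 * K ^+ 2 * (b - a) ^+ 2 <= N%:R * e ^+ 2.
  by rewrite -ler_pdivrMr ?exprn_gt0// ltW// truncnS_gt.
have N0 : (0 < N)%N by [].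
clearbody N; have [s [w [hs w1 hw]]] := bernstein_partition ab N0.
set D := 3 * _ / _ in hw.
pose p := \sum_(j < N.+1) f (s j) *: w j.
have hp : op_norm_le (op_poly p T - Y) e.
  apply/op_norm_leP; first exact: ltW.
  move=> x.
  pose v (j : 'I_N.+1) := op_poly (w j) T x.
  have xE : x = \sum_j v j.
    by rewrite -bop_sum -op_poly_sum w1 op_polyC scale1r.
  have h1 : hnorm ((op_poly p T - Y) x)
      <= K * \sum_j hnorm (T (v j) - (s j)%:C *: v j).
    have -> : (op_poly p T - Y) x = - \sum_j (Y (v j) - (f (s j))%:C *: v j).
      rewrite sumrB opprB bopD bopN; congr (_ - _).
        rewrite /p op_poly_sum bop_sum; apply: eq_bigr => j _.
        by rewrite op_polyZ.
      by rewrite {1}xE linear_sum.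
    rewrite hnormN mulr_sumr; apply: le_trans (hnorm_sum _ _) _.
    by apply: ler_sum => j _; apply: hY; exact: hs.
  rewrite -!hnorm_sqr.
  apply: (@le_trans _ _ (K ^+ 2 * (N.+1%:R * (D * hnorm x ^+ 2)))).
    apply: le_trans (_ : (K * \sum_j hnorm (T (v j) - (s j)%:C *: v j)) ^+ 2 <= _).
      rewrite lerXn2r ?nnegrE ?hnorm_ge0// mulr_ge0// sumr_ge0// => j _.
      exact: hnorm_ge0.
    rewrite exprMn ler_wpM2l ?sqr_ge0//; apply: le_trans (sqr_sum_le _) _.
    rewrite ler_wpM2l//.
    (* The sum of the squared errors is the quadratic form of a polynomial in T,
       hence it is controlled by the values of that polynomial on [a, b]. *)
    pose q j := ('X - (s j)%:P) * w j.
    have -> : \sum_(j < N.+1) hnorm (T (v j) - (s j)%:C *: v j) ^+ 2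
        = rdot (op_poly (\sum_(j < N.+1) q j * q j) T x) x.
      rewrite op_poly_sum bop_sum.
      transitivity (\sum_(j < N.+1) rdot (op_poly (q j * q j) T x) x).
        apply: eq_bigr => j _; rewrite op_polyM bopM.
        rewrite (op_poly_symmetric _ sT (op_poly (q j) T x)) -hnorm_sqr.
        by rewrite /q op_polyM op_polyD op_polyN op_polyX op_polyC !bopE.
      elim/big_rec2: _ => [|j u z _ ->]; first by rewrite rdot0l.
      by rewrite rdotDl.
    have := @op_poly_le _ _ (\sum_(j < N.+1) q j * q j - D%:P) T x sT.
    rewrite op_polyD op_polyN op_polyC !bopE !rdotE hnorm_sqr subr_le0; apply.
    move=> l /sp hl; have := hw l hl.
    rewrite hornerD hornerN hornerC subr_le0; congr (_ <= _).
    rewrite -horner_evalE raddf_sum /=; apply: eq_bigr => j _.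
    by rewrite horner_evalE /q !hornerE expr2 /=; ring.
  have N0' : 0 < N%:R :> R by rewrite ltr0n.
  have N1 : 1 <= N%:R :> R by rewrite ler1n.
  suff hKD : K ^+ 2 * (N.+1%:R * D) <= e ^+ 2.
    have := ler_wpM2r (sqr_ge0 (hnorm x)) hKD.
    by rewrite -(mulrA (K ^+ 2)) -(mulrA N.+1%:R).
  rewrite /D -natr1.
  have -> : K ^+ 2 * ((N%:R + 1) * (3 * (b - a) ^+ 2 / N%:R ^+ 2))
    = (N%:R + 1) * (6 * K ^+ 2 * (b - a) ^+ 2) / (2 * N%:R ^+ 2).
    by field; rewrite gt_eqF.
  rewrite ler_pdivrMr ?mulr_gt0 ?exprn_gt0//.
  have hN2 : (N%:R + 1) * (6 * K ^+ 2 * (b - a) ^+ 2)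
    <= (N%:R + 1) * (N%:R * e ^+ 2) by rewrite ler_wpM2l// addr_ge0.
  apply: le_trans hN2 _.
  have : 0 <= (N%:R - 1) * (N%:R * e ^+ 2).
    by rewrite mulr_ge0 ?subr_ge0// mulr_ge0 ?sqr_ge0.
  lra.
exists p => // l hl.
have [g gE] : exists g, p - (p.[l])%:P = g * ('X - l%:P).
  by apply/factor_theorem; rewrite rootE !hornerE subrr.
have [d d0 /op_normP hd] := op_norm_le_exists (op_poly g T).
apply/ler_addgt0Pr => eps eps0.
have dK : 0 < d + K by rewrite ltr_pwDl.
have eta0 : 0 < eps / (d + K) by rewrite divr_gt0.
have [x x0 hx] := spectrum_approx sT hl eta0.
rewrite -(ler_pM2r x0) -hnormZ.
have -> : (p.[l] - f l)%:C *: x =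
   - op_poly g T (T x - l%:C *: x) + (Y x - (f l)%:C *: x) + (op_poly p T - Y) x.
  have -> : op_poly g T (T x - l%:C *: x) = op_poly (g * ('X - l%:P)) T x.
    by rewrite op_polyM op_polyD op_polyN op_polyX op_polyC !bopE.
  rewrite -gE op_polyD op_polyN op_polyC !bopE.
  by apply: rdot_ext => z; rewrite !rdotE; ring.
move/op_normP: hp => /(_ x) hp.
apply: le_trans (hnormD _ _) _; apply: le_trans (lerD (hnormD _ _) hp) _.
rewrite hnormN mulrDl addrC lerD2l.
apply: le_trans (lerD (hd _) (hY l x (sp l hl))) _.
rewrite -mulrDl; apply: le_trans (ler_wpM2l (ltW dK) hx) _.
by rewrite mulrA mulrCA mulfV ?mulr1// gt_eqF.
Qed.

End FunctionalCalculus.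

(** * Positive invertible operators and the mean *)
Section PositiveInvertible.
Context {R : realType} {H : hilbertType R}.
Implicit Types (x y z : H) (A B C S T Y : 'B(H)).

Lemma positive_invertibleP T : positive_invertible T <->
  [/\ symmetric T, op_ge_scal T 0 & invertible T].
Proof.
have s0 : symmetric (0 : 'B(H)) by exact: symmetric0.
split=> -[].
  move=> /self_adjointP sT /op_le_rdot h iT; split=> // x.
  by have := h x; rewrite bop0 rdot0l mul0r.
move=> sT h iT; split=> //; first exact/self_adjointP.
apply: op_le_symmetric => // x.
by have := h x; rewrite bop0 rdot0l mul0r.
Qed.

Lemma positive_invertible_bounds T : positive_invertible T ->
  exists a b, [/\ 0 < a, a < b, op_ge_scal T a & op_le_scal T b].
Proof.
move=> /positive_invertibleP[sT T0 [S hS]].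
have [a a0 ha] := inverse_lower_bound hS sT T0.
have [c c0 /op_norm_le_scal /(_ c0) hc] := op_norm_le_exists T.
exists a, (a + c); split=> //; first by rewrite ltrDl.
move=> x; apply: le_trans (hc x) _.
by rewrite ler_wpM2r ?rdot_ge0// lerDr ltW.
Qed.

Lemma positive_invertibleV T S : is_inverse T S ->
  positive_invertible T -> positive_invertible S.
Proof.
move=> hS /positive_invertibleP[sT T0 _]; apply/positive_invertibleP; split.
- exact: symmetric_inverse hS sT.
- exact: inverse_ge0 hS sT T0.
- by exists T; exact: is_inverse_sym.
Qed.

Lemma positive_invertibleZ T (t : R) : 0 < t ->
  positive_invertible T -> positive_invertible (t%:C *: T).
Proof.
move=> t0 /positive_invertibleP[sT T0 [S [h1 h2]]].
apply/positive_invertibleP; split.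
- exact: symmetricZ.
- move=> x; have := T0 x; rewrite !mul0r bopZ rdotZl => h.
  by rewrite mulr_ge0// ltW.
have e : t%:C * t^-1%:C = 1 :> R[i].
  by rewrite -rmorphM /= mulfV// gt_eqF.
exists (t^-1%:C *: S); split;
  by rewrite bop_scaleMl bop_scaleMr scalerA ?h1 ?h2 1?(mulrC t^-1%:C) e scale1r.
Qed.

Lemma positive_invertible_conj T S : symmetric S -> invertible S ->
  positive_invertible T -> positive_invertible (S * T * S).
Proof.
move=> sS [S' hS] /positive_invertibleP[sT T0 [T' hT]].
apply/positive_invertibleP; split.
- exact: symmetric_conj.
- by move=> x; have := T0 (S x); rewrite !mul0r !bopM sS.
by exists (S' * (T' * S')); apply: (is_inverseM _ hS); exact: is_inverseM.
Qed.

(** From S^2 = B one gets (S + t) (S - t) = B - s for s = t^2, and S + t is bounded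
    below by t since S is positive; this is the local bound that identifies S as
    the power 1/2 of B.  For the inverse D of S, use in addition
    D - t^-1 = - t^-1 D (S - t). *)
Lemma op_pow_half B : positive_invertible B ->
  exists S D, [/\ symmetric S, S * S = B, is_inverse S D,
    op_pow B 2^-1 = S & op_pow B (- 2^-1) = D].
Proof.
move=> pB; have /positive_invertibleP[sB _ [B' [BB' B'B]]] := pB.
have [a [b [a0 ab ha hb]]] := positive_invertible_bounds pB.
have [S [sS SS [m m0 hm]]] := op_sqrt_exists a0 sB ha.
have hD : is_inverse S (S * B').
  by apply: (is_inverse_lr (L := B' * S)); [rewrite -mulrA SS|rewrite mulrA SS].
set D := S * B' in hD; have [hSD hDS] := hD.
pose k := a `^ 2^-1; have k0 : 0 < k by rewrite powR_gt0.
have [d d0 /op_normP hd] := op_norm_le_exists D.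
have sqrt_bound s x : a <= s <= b ->
    hnorm (S x - (s `^ 2^-1)%:C *: x) <= k^-1 * hnorm (B x - s%:C *: x).
  move=> /andP[as_ _].
  have s0 : 0 < s by apply: lt_le_trans as_.
  set t := s `^ 2^-1.
  have kt : k <= t by rewrite ge0_ler_powR ?nnegrE ?invr_ge0// ltW.
  have tt : t * t = s by rewrite /t powR12_sqrt ?ltW// -expr2 sqr_sqrtr// ltW.
  have t0 : 0 < t by exact: lt_le_trans kt.
  set z := S x - _.
  have -> : B x - s%:C *: x = S z + t%:C *: z.
    rewrite /z -SS bopM -tt; apply: rdot_ext => y.
    by rewrite bop_addr bop_oppr bop_scaler !rdotE; ring.
  clearbody z; rewrite mulrC ler_pdivlMr//.
  apply: (@le_trans _ _ (hnorm z * t)); first by rewrite ler_wpM2l ?hnorm_ge0.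
  rewrite -ler_sqr ?nnegrE ?mulr_ge0 ?hnorm_ge0 ?(ltW t0)//.
  rewrite exprMn !hnorm_sqr !rdotE (rdotC z (S z)).
  have := rdot_ge0 (S z).
  have h1 : 0 <= t * rdot (S z) z.
    rewrite mulr_ge0 ?(ltW t0)//; apply: le_trans (hm z).
    by rewrite mulr_ge0 ?rdot_ge0// ltW.
  by move=> h2; rewrite expr2; lra.
exists S, D; split=> //; apply: fcalcE => //.
  apply: (is_fcalc_of_local_bound sB ha hb ab) sqrt_bound.
  by rewrite invr_ge0 ltW.
apply: (@is_fcalc_of_local_bound _ _ _ _ _ a b (k^-1 * d * k^-1)) => //.
  by rewrite !mulr_ge0 ?invr_ge0 ?ltW.
move=> s x hs; have /andP[as_ _] := hs.
have s0 : 0 < s by apply: lt_le_trans as_.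
have kt : k <= s `^ 2^-1 by rewrite ge0_ler_powR ?nnegrE ?invr_ge0// ltW.
have := sqrt_bound s x hs.
rewrite powRN; set t := s `^ 2^-1 in kt * => ht.
have t0 : 0 < t by exact: lt_le_trans kt.
have -> : D x - t^-1%:C *: x = - (t^-1%:C *: D (S x - t%:C *: x)).
  rewrite bop_addr bop_oppr bop_scaler -bopM hDS bop1; apply: rdot_ext => y.
  by rewrite !rdotE; field; rewrite gt_eqF.
rewrite hnormN hnormZ ger0_norm ?invr_ge0 ?(ltW t0)// -!mulrA.
apply: ler_pM; rewrite ?invr_ge0 ?hnorm_ge0 ?(ltW t0)//.
  by rewrite lef_pV2.
by apply: le_trans (hd _) _; rewrite ler_wpM2l// ltW.
Qed.

(** The identity (T - q) T^-1 (T - q) = T - 2 q + q^2 T^-1, as quadratic forms. *)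
Lemma inverse_form_shift T T' (q : R) x : is_inverse T T' -> symmetric T ->
  rdot (T' (T x - q%:C *: x)) (T x - q%:C *: x)
  = rdot (T x) x - 2 * q * rdot x x + q ^+ 2 * rdot (T' x) x.
Proof.
move=> hi sT; have sT' := symmetric_inverse hi sT; have [h1 h2] := hi.
rewrite bop_addr bop_oppr bop_scaler -bopM h2 bop1 !rdotE.
rewrite (sT' x (T x)) -bopM h2 bop1 (rdotC x (T x)); ring.
Qed.

(** Adding the two hypotheses and subtracting 2 |x|^2, both sides become shifted
    inverse forms: q^-1 (Y - q) Y^-1 (Y - q) <= r s^-1 (C - s) C^-1 (C - s). *)
Lemma mean_local_bound C C' Y Y' (r s q m c : R) :
  0 < r -> 0 < s -> 0 < q -> 0 < m ->
  is_inverse C C' -> symmetric C -> is_inverse Y Y' -> symmetric Y ->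
  op_ge_scal Y' m -> op_le_scal C' c ->
  (forall x, q^-1 * rdot (Y x) x <= r * s^-1 * rdot (C x) x + (1 - r) * rdot x x) ->
  (forall x, q * rdot (Y' x) x <= r * s * rdot (C' x) x + (1 - r) * rdot x x) ->
  forall x, rdot (Y x - q%:C *: x) (Y x - q%:C *: x)
    <= r * c * (q / (s * m)) * rdot (C x - s%:C *: x) (C x - s%:C *: x).
Proof.
move=> r0 s0 q0 m0 iC sC iY sY hm hc h1 h2 x.
have hz := hm (Y x - q%:C *: x); have hw := hc (C x - s%:C *: x).
rewrite (inverse_form_shift _ _ iY sY) in hz.
rewrite (inverse_form_shift _ _ iC sC) in hw.
have {}h1 := h1 x; have {}h2 := h2 x.
set Z := rdot (Y x - _) _ in hz *; set W := rdot (C x - _) _ in hw *.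
set y := rdot (Y x) x in hz h1; set y' := rdot (Y' x) x in hz h2.
set u := rdot (C x) x in hw h1; set u' := rdot (C' x) x in hw h2.
set n := rdot x x in hz hw h1 h2.
have k1 : y - 2 * q * n + q ^+ 2 * y' = q * ((q^-1 * y) + q * y' - 2 * n).
  by field; rewrite gt_eqF.
have k2 : r / s * (u - 2 * s * n + s ^+ 2 * u')
  = r * s^-1 * u + r * s * u' - 2 * r * n by field; rewrite gt_eqF.
have k3 : q * ((q^-1 * y) + q * y' - 2 * n)
    <= q * (r / s * (u - 2 * s * n + s ^+ 2 * u')).
  by rewrite ler_pM2l// k2; lra.
have k4 : q * (r / s * (u - 2 * s * n + s ^+ 2 * u')) <= q * (r / s * (c * W)).
  by rewrite ler_pM2l// ler_pM2l// divr_gt0.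
have -> : r * c * (q / (s * m)) * W = q * (r / s * (c * W)) / m.
  by field; rewrite !gt_eqF.
rewrite ler_pdivlMr//; lra.
Qed.

End PositiveInvertible.

Theorem theorem2p5 (R : realType) (H : hilbertType R) (r : R)
    (r_gt0 : 0 < r) (r_lt1 : r < 1)
    (M : 'B(H) -> 'B(H) -> 'B(H))
    (M_pos : forall A B, positive_invertible A -> positive_invertible B ->
       positive_invertible (M A B))
    (M_le : forall A B, positive_invertible A -> positive_invertible B ->
       op_le (M A B) (r%:C *: A + (1 - r)%:C *: B))
    (M_hom : forall A B (t : R), positive_invertible A ->
       positive_invertible B -> 0 < t ->
       M (t%:C *: A) B = (t `^ r)%:C *: M A B)
    (M_inv : forall A B, positive_invertible A -> positive_invertible B ->
       op_inv (M A B) = M (op_inv A) (op_inv B)) :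
  forall A B, positive_invertible A -> positive_invertible B ->
    M A B = geometric_mean r A B.
Proof.
move=> A B pA pB.
(* The bound on the mean, applied to t A0 and B0 and rewritten by homogeneity. *)
have scaled A0 B0 t x : positive_invertible A0 -> positive_invertible B0 ->
    0 < t -> t `^ r * rdot (M A0 B0 x) x
      <= r * t * rdot (A0 x) x + (1 - r) * rdot (B0 x) x.
  move=> pA0 pB0 t0.
  have /op_le_rdot/(_ x) := M_le _ _ (positive_invertibleZ t0 pA0) pB0.
  by rewrite M_hom// !bopE !rdotE mulrA.
have [S [D [sS SS iSD hS hD]]] := op_pow_half pB.
have [hSD hDS] := iSD; have sD := symmetric_inverse iSD sS.
have SDK y : S (D y) = y by rewrite -bopM hSD.
have DSK y : D (S y) = y by rewrite -bopM hDS.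
rewrite /geometric_mean hS hD.
have pX := M_pos _ _ pA pB; set X := M A B in pX *.
have /positive_invertibleP[_ _ [A' iA]] := pA.
have iB : is_inverse B (D * D) by rewrite -SS; exact: is_inverseM.
have /positive_invertibleP[_ _ [X' iX]] := pX.
have X'E : X' = M A' (D * D).
  by rewrite -(op_invE iA) -(op_invE iB) -M_inv// (op_invE iX).
have pA' := positive_invertibleV iA pA; have pB' := positive_invertibleV iB pB.
have iDS := is_inverse_sym iSD.
have iS : invertible S by exists D.
have iD : invertible D by exists S.
have pC := positive_invertible_conj sD iD pA.
have iC : is_inverse (D * A * D) (S * A' * S).
  by rewrite -(mulrA S); apply: (is_inverseM _ iDS); exact: is_inverseM.
have pY := positive_invertible_conj sD iD pX.
have iY : is_inverse (D * X * D) (S * X' * S).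
  by rewrite -(mulrA S); apply: (is_inverseM _ iDS); exact: is_inverseM.
have /positive_invertibleP[sC _ _] := pC.
have /positive_invertibleP[sY _ _] := pY.
have pC' := positive_invertibleV iC pC; have pY' := positive_invertibleV iY pY.
have [a [b [a0 ab ha hb]]] := positive_invertible_bounds pC.
have [c' [c [c'0 c'c _ hc]]] := positive_invertible_bounds pC'.
have c0 : 0 < c by exact: lt_trans c'c.
have [m [m' [m0 _ hm _]]] := positive_invertible_bounds pY'.
suff -> : op_pow (D * A * D) r = D * X * D.
  by rewrite -!mulrA hDS mulr1 !mulrA hSD mul1r.
apply: fcalcE => //.
pose K := Num.sqrt (r * c * (b `^ r / (a * m))).
have K0 : 0 <= K by exact: sqrtr_ge0.
apply: (@is_fcalc_of_local_bound _ _ _ _ _ a b K) => //.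
move=> s x /andP[as_ sb].
have s0 : 0 < s by exact: lt_le_trans as_.
set q := s `^ r; have q0 : 0 < q by exact: powR_gt0.
have qV : s^-1 `^ r = q^-1.
  apply: (mulIf (lt0r_neq0 q0)); rewrite mulVf ?gt_eqF//.
  by rewrite -powRM ?invr_ge0 ?(ltW s0)// mulVf ?gt_eqF// powR1.
(* The scaled bound with t = s^-1, conjugated by D. *)
have h1 y : q^-1 * rdot ((D * X * D) y) y
    <= r * s^-1 * rdot ((D * A * D) y) y + (1 - r) * rdot y y.
  have := scaled A B s^-1 (D y) pA pB; rewrite invr_gt0 => /(_ s0).
  rewrite -/X; clearbody X; rewrite qV -[B]SS !bopM !sD.
  by rewrite (sS (S (D y))) !SDK.
(* The scaled bound for the inverses with t = s, conjugated by S. *)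
have h2 y : q * rdot ((S * X' * S) y) y
    <= r * s * rdot ((S * A' * S) y) y + (1 - r) * rdot y y.
  have := scaled A' (D * D) s (S y) pA' pB' s0; rewrite -X'E.
  rewrite !bopM !sS.
  by rewrite (sD (D (S y))) !DSK.
have := mean_local_bound r_gt0 s0 q0 m0 iC sC iY sY hm hc h1 h2 x.
have b0 : 0 < b by exact: lt_trans ab.
have E0 : 0 <= r * c * (b `^ r / (a * m)).
  by rewrite !mulr_ge0 ?invr_ge0 ?mulr_ge0 ?powR_ge0// ltW.
move=> h; rewrite -ler_sqr ?nnegrE ?mulr_ge0 ?sqrtr_ge0//.
rewrite exprMn !hnorm_sqr sqr_sqrtr//; apply: le_trans h _.
apply: ler_wpM2r; first exact: rdot_ge0.
apply: ler_wpM2l; first by rewrite mulr_ge0// ltW.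
apply: ler_pM; [exact: ltW|by rewrite invr_ge0 ltW// mulr_gt0| |].
  by rewrite ge0_ler_powR ?nnegrE// ltW.
by rewrite lef_pV2 ?posrE ?mulr_gt0// ler_pM2r.
Qed.
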